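(* Over $\mathrm{ZFU}_{\mathrm{R}}$: (1) Tail$^+$ implies (every instance of) RP; (2) Plenitude$^+$ implies Duplication.
   Context: The language of urelement set theory has $\in$ and a unary predicate $\mathcal{A}$ for urelements. $\mathrm{ZFU}_{\mathrm{R}}$ = ZU (urelements have no members, Extensionality for sets, Foundation, Pairing, Union, Powerset, Infinity, Separation scheme) + Replacement scheme; no choice is assumed. For a set $A$ of urelements, a tail of $A$ is a set $B$ of urelements disjoint from $A$ such that every set of urelements disjoint from $A$ injects into $B$. Tail$^+$: every set of urelements has a well-orderable tail. Plenitude$^+$: every set is equinumerous with some set of urelements. Duplication: every set $A$ of urelements has a duplicate, i.e. a set of urelements disjoint from $A$ and equinumerous with it. RP (scheme): for each formula $\varphi$, for every set $x$ there is a transitive set $t\supseteq x$ such that for all $x_1,\dots,x_n\in t$, $\varphi(x_1,\dots,x_n)\leftrightarrow\varphi^t(x_1,\dots,x_n)$. *)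

(* Defs.v *)
(** First-order formulas in the language {∈, 𝒜} with equality; variables are
    de Bruijn indices. *)
Inductive form : Type :=
| FEq (i j : nat)
| FMem (i j : nat)
| FUr (i : nat)
| FBot
| FImp (p q : form)
| FAnd (p q : form)
| FOr (p q : form)
| FAll (p : form)
| FEx (p : form).

Fixpoint free (p : form) (k : nat) : Prop :=
  match p with
  | FEq i j | FMem i j => k = i \/ k = j
  | FUr i => k = i
  | FBot => False
  | FImp p q | FAnd p q | FOr p q => free p k \/ free q k
  | FAll p | FEx p => free p (S k)
  end.

Record structure : Type := {
  dom :> Type;
  mem : dom -> dom -> Prop;
  ur : dom -> Prop
}.

Arguments mem {M} x y : rename.
Arguments ur {M} x : rename.

Declare Scope zfu_scope.
Notation "x ∈ y" := (mem x y) (at level 70, no associativity) : zfu_scope.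
Open Scope zfu_scope.

Definition scons {X : Type} (a : X) (e : nat -> X) (k : nat) : X :=
  match k with
  | O => a
  | S k' => e k'
  end.

Fixpoint sat (M : structure) (e : nat -> M) (p : form) : Prop :=
  match p with
  | FEq i j => e i = e j
  | FMem i j => e i ∈ e j
  | FUr i => ur (e i)
  | FBot => False
  | FImp p q => sat M e p -> sat M e q
  | FAnd p q => sat M e p /\ sat M e q
  | FOr p q => sat M e p \/ sat M e q
  | FAll p => forall a : M, sat M (scons a e) p
  | FEx p => exists a : M, sat M (scons a e) p
  end.

(** Truth in [M] of the relativization φ^t: all quantifiers are restricted to
    the members of [t]. *)
Fixpoint sat_rel (M : structure) (t : M) (e : nat -> M) (p : form) : Prop :=
  match p with
  | FEq i j => e i = e j
  | FMem i j => e i ∈ e j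
  | FUr i => ur (e i)
  | FBot => False
  | FImp p q => sat_rel M t e p -> sat_rel M t e q
  | FAnd p q => sat_rel M t e p /\ sat_rel M t e q
  | FOr p q => sat_rel M t e p \/ sat_rel M t e q
  | FAll p => forall a : M, a ∈ t -> sat_rel M t (scons a e) p
  | FEx p => exists a : M, a ∈ t /\ sat_rel M t (scons a e) p
  end.

Definition is_set {M : structure} (x : M) : Prop := ~ ur x.

Definition subset {M : structure} (x y : M) : Prop :=
  forall z : M, z ∈ x -> z ∈ y.

Definition is_upair {M : structure} (p a b : M) : Prop :=
  is_set p /\ forall z : M, z ∈ p <-> z = a \/ z = b.

(** [p] is the Kuratowski pair {{a}, {a, b}}. *)
Definition is_opair {M : structure} (p a b : M) : Prop :=
  exists u v : M, is_upair u a a /\ is_upair v a b /\ is_upair p u v.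

Definition related {M : structure} (r x y : M) : Prop :=
  exists p : M, p ∈ r /\ is_opair p x y.

Definition is_function {M : structure} (f A B : M) : Prop :=
  is_set f
  /\ (forall p : M, p ∈ f ->
        exists x y : M, x ∈ A /\ y ∈ B /\ is_opair p x y)
  /\ (forall x : M, x ∈ A -> exists! y : M, related f x y).

Definition is_injection {M : structure} (f A B : M) : Prop :=
  is_function f A B
  /\ forall x x' y : M, related f x y -> related f x' y -> x = x'.

Definition is_bijection {M : structure} (f A B : M) : Prop :=
  is_injection f A B
  /\ forall y : M, y ∈ B -> exists x : M, x ∈ A /\ related f x y.

Definition injects {M : structure} (A B : M) : Prop :=
  exists f : M, is_injection f A B.

Definition equinumerous {M : structure} (A B : M) : Prop :=
  exists f : M, is_bijection f A B.

(** [r] is a strict well-order of [B], as seen inside [M]: only subsets of [B]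
    that are sets of [M] are required to have a least element. *)
Definition well_orders {M : structure} (r B : M) : Prop :=
  is_set r
  /\ (forall x : M, x ∈ B -> ~ related r x x)
  /\ (forall x y z : M, x ∈ B -> y ∈ B -> z ∈ B ->
        related r x y -> related r y z -> related r x z)
  /\ (forall x y : M, x ∈ B -> y ∈ B ->
        related r x y \/ x = y \/ related r y x)
  /\ (forall C : M, is_set C -> subset C B -> (exists x : M, x ∈ C) ->
        exists m : M, m ∈ C /\
          forall x : M, x ∈ C -> x = m \/ related r m x).

Definition well_orderable {M : structure} (B : M) : Prop :=
  exists r : M, well_orders r B.

Definition urelements_no_members (M : structure) : Prop :=
  forall x : M, ur x -> forall y : M, ~ y ∈ x.

Definition extensionality (M : structure) : Prop :=
  forall x y : M, is_set x -> is_set y ->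
    (forall z : M, z ∈ x <-> z ∈ y) -> x = y.

Definition foundation (M : structure) : Prop :=
  forall x : M, (exists y : M, y ∈ x) ->
    exists y : M, y ∈ x /\ forall z : M, z ∈ y -> ~ z ∈ x.

Definition pairing (M : structure) : Prop :=
  forall x y : M, exists p : M, is_upair p x y.

Definition union (M : structure) : Prop :=
  forall x : M, is_set x ->
    exists u : M, is_set u /\
      forall z : M, z ∈ u <-> exists y : M, y ∈ x /\ z ∈ y.

Definition powerset (M : structure) : Prop :=
  forall x : M, is_set x ->
    exists p : M, is_set p /\
      forall z : M, z ∈ p <-> is_set z /\ subset z x.

Definition infinity (M : structure) : Prop :=
  exists w : M, is_set w
    /\ (exists o : M, o ∈ w /\ is_set o /\ forall z : M, ~ z ∈ o)
    /\ forall x : M, x ∈ w ->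
         exists s : M, s ∈ w /\ is_set s /\
           forall z : M, z ∈ s <-> z ∈ x \/ z = x.

(** In the schemes, [e] supplies the parameters. *)
Definition separation (M : structure) : Prop :=
  forall (p : form) (e : nat -> M) (x : M), is_set x ->
    exists y : M, is_set y /\
      forall z : M, z ∈ y <-> z ∈ x /\ sat M (scons z e) p.

(** Variable 0 is the argument and variable 1 the value. *)
Definition replacement (M : structure) : Prop :=
  forall (p : form) (e : nat -> M) (x : M), is_set x ->
    (forall a : M, a ∈ x ->
       exists! b : M, sat M (scons a (scons b e)) p) ->
    exists y : M, is_set y /\
      forall a : M, a ∈ x ->
        exists b : M, b ∈ y /\ sat M (scons a (scons b e)) p.

Definition ZU (M : structure) : Prop :=
  urelements_no_members M /\ extensionality M /\ foundation M /\ pairing M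
  /\ union M /\ powerset M /\ infinity M /\ separation M.

Definition ZFU_R (M : structure) : Prop := ZU M /\ replacement M.

Definition ur_set {M : structure} (A : M) : Prop :=
  is_set A /\ forall x : M, x ∈ A -> ur x.

Definition disjoint {M : structure} (A B : M) : Prop :=
  forall x : M, ~ (x ∈ A /\ x ∈ B).

Definition is_tail {M : structure} (B A : M) : Prop :=
  ur_set B /\ disjoint B A
  /\ forall C : M, ur_set C -> disjoint C A -> injects C B.

Definition tail_plus (M : structure) : Prop :=
  forall A : M, ur_set A -> exists B : M, is_tail B A /\ well_orderable B.

Definition plenitude_plus (M : structure) : Prop :=
  forall x : M, is_set x -> exists A : M, ur_set A /\ equinumerous x A.

Definition is_duplicate {M : structure} (B A : M) : Prop :=
  ur_set B /\ disjoint B A /\ equinumerous B A.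

Definition duplication (M : structure) : Prop :=
  forall A : M, ur_set A -> exists B : M, is_duplicate B A.

Definition transitive_set {M : structure} (t : M) : Prop :=
  is_set t /\ forall y z : M, y ∈ t -> z ∈ y -> z ∈ t.

(** The instance of RP for [p]. Only the free variables of [p] are required to
    take values in [t], so that sentences are reflected too when [t] is empty. *)
Definition RP (M : structure) (p : form) : Prop :=
  forall x : M, is_set x ->
    exists t : M, transitive_set t /\ subset x t /\
      forall e : nat -> M, (forall k : nat, free p k -> e k ∈ t) ->
        (sat M e p <-> sat_rel M t e p).

(* Main.v *)
(** (1) Say that [y] is over [A] when every urelement in its transitive closure
    lies in [A]. Minimizing the cardinality of a well-orderable tail, every set
    of urelements extends to an [A] with a tail [B] such that every set [E] of
    urelements disjoint from [A] has a copy disjoint from [A ∪ E]. Then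
    [B ⊔ B] injects into [B], so there are injections [l, r : B -> B] with
    disjoint ranges, and the sets [A_k = A ∪ (B \ r^k(B))] increase, with
    [A_(k+1) \ A_k] as large as [B]. Every object can be moved over [A_(k+1)]
    by an automorphism of the universe, induced by urelement swaps, that fixes
    everything over [A_k]. Hence an existential statement with parameters over
    [A_k] has a witness over [A_(k+1)] as soon as it has one at all. Collection
    holds for the objects over a fixed set of urelements, because these are
    stratified by a cumulative hierarchy; so [omega] steps yield a transitive
    set passing the Tarski-Vaught test.

    (2) Let [h] be a bijection from [A × P(A)] onto a set of urelements. A Cantor
    diagonal set [d(a)] ensures that [h(a, d(a))] is not in [A], and
    [a ↦ h(a, d(a))] is injective. *)

From Stdlib Require Import Classical ClassicalEpsilon FunctionalExtensionality List Lia.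
Require Import Defs.
Import ListNotations.

(** Interleaves the environment [e] with a stock of parameters [r]. *)
Fixpoint mix {X : Type} (e r : nat -> X) (n : nat) : X :=
  match n with
  | O => e O
  | S O => r O
  | S (S m) => mix (fun k => e (S k)) (fun k => r (S k)) m
  end.

Lemma mix_l {X} (i : nat) : forall e r : nat -> X, mix e r (2 * i) = e i.
Proof.
  induction i as [|i IH]; intros e r; [reflexivity|].
  replace (2 * S i) with (S (S (2 * i))) by lia.
  exact (IH (fun k => e (S k)) (fun k => r (S k))).
Qed.

Lemma mix_r {X} (i : nat) : forall e r : nat -> X, mix e r (S (2 * i)) = r i.
Proof.
  induction i as [|i IH]; intros e r; [reflexivity|].
  replace (S (2 * S i)) with (S (S (S (2 * i)))) by lia.
  exact (IH (fun k => e (S k)) (fun k => r (S k))).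
Qed.

Lemma mix_comp {X Y} (h : X -> Y) (n : nat) : forall e r : nat -> X,
  h (mix e r n) = mix (fun k => h (e k)) (fun k => h (r k)) n.
Proof.
  induction n as [n IH] using (well_founded_induction Wf_nat.lt_wf); intros e r.
  destruct n as [|[|n]]; try reflexivity. simpl. now rewrite IH by lia.
Qed.

Definition up (s : nat -> nat) (k : nat) : nat :=
  match k with O => O | S k' => S (s k') end.

Fixpoint ren (s : nat -> nat) (p : form) : form :=
  match p with
  | FEq i j => FEq (s i) (s j)
  | FMem i j => FMem (s i) (s j)
  | FUr i => FUr (s i)
  | FBot => FBot
  | FImp p q => FImp (ren s p) (ren s q)
  | FAnd p q => FAnd (ren s p) (ren s q)
  | FOr p q => FOr (ren s p) (ren s q)
  | FAll p => FAll (ren (up s) p)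
  | FEx p => FEx (ren (up s) p)
  end.

Lemma sat_ren (M : structure) (p : form) : forall (s : nat -> nat) (e : nat -> M),
  sat M e (ren s p) <-> sat M (fun k => e (s k)) p.
Proof.
  assert (E : forall (s : nat -> nat) (a : M) e,
    (fun k => scons a e (up s k)) = scons a (fun k => e (s k))).
  { intros s a e. apply functional_extensionality. now intros [|k]. }
  induction p; intros s e; simpl; try tauto;
    try (rewrite IHp1, IHp2; tauto).
  - split; intros H a; specialize (H a); rewrite IHp, E in *; exact H.
  - split; intros [a H]; exists a; rewrite IHp, E in *; exact H.
Qed.

Section ZFU.

Context (M : structure) (HM : ZFU_R M).

Let HZ : ZU M := proj1 HM.

Let has_infinity : infinity M.
Proof. apply HZ. Qed.

Definition some_set : M :=
  proj1_sig (constructive_indefinite_description _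
    has_infinity).

Notation env := (nat -> dom M).
Notation tl e := (fun k : nat => e (S k)).

Definition definable (P : env -> Prop) : Prop :=
  exists (p : form) (r : env), forall e : env, P e <-> sat M (mix e r) p.

Definition definable_term (f : env -> M) : Prop :=
  definable (fun e => e 0 = f (tl e)).

Lemma def_ext (P Q : env -> Prop) :
  (forall e, P e <-> Q e) -> definable P -> definable Q.
Proof.
  intros H (p & r & Hp). exists p, r. intros e. rewrite <- H. apply Hp.
Qed.

Lemma mix_ren_l (e r1 r2 : env) :
  (fun k => mix e (mix r1 r2) (mix (fun i => 2 * i) (fun i => S (2 * (2 * i))) k)) = mix e r1.
Proof.
  apply functional_extensionality; intros k. rewrite (mix_comp (mix e (mix r1 r2))).
  f_equal; apply functional_extensionality; intros i.
  - apply mix_l.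
  - now rewrite mix_r, mix_l.
Qed.

Lemma mix_ren_r (e r1 r2 : env) :
  (fun k => mix e (mix r1 r2) (mix (fun i => 2 * i) (fun i => S (2 * (S (2 * i)))) k)) = mix e r2.
Proof.
  apply functional_extensionality; intros k. rewrite (mix_comp (mix e (mix r1 r2))).
  f_equal; apply functional_extensionality; intros i.
  - apply mix_l.
  - now rewrite mix_r, mix_r.
Qed.

Lemma def_bin (op : form -> form -> form) (c : Prop -> Prop -> Prop) (P Q : env -> Prop) :
  (forall e p q, sat M e (op p q) <-> c (sat M e p) (sat M e q)) ->
  (forall A A' B B' : Prop, (A <-> A') -> (B <-> B') -> (c A B <-> c A' B')) ->
  definable P -> definable Q -> definable (fun e => c (P e) (Q e)).
Proof.
  intros Hop Hc (p & r1 & Hp) (q & r2 & Hq).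
  exists (op (ren (mix (fun i => 2 * i) (fun i => S (2 * (2 * i)))) p)
             (ren (mix (fun i => 2 * i) (fun i => S (2 * (S (2 * i))))) q)), (mix r1 r2).
  intros e. rewrite Hop. apply Hc; rewrite sat_ren.
  - rewrite mix_ren_l. apply Hp.
  - rewrite mix_ren_r. apply Hq.
Qed.

Lemma def_and P Q : definable P -> definable Q -> definable (fun e => P e /\ Q e).
Proof. apply (def_bin FAnd and); simpl; tauto. Qed.

Lemma def_or P Q : definable P -> definable Q -> definable (fun e => P e \/ Q e).
Proof. apply (def_bin FOr or); simpl; tauto. Qed.

Lemma def_imp P Q : definable P -> definable Q -> definable (fun e => P e -> Q e).
Proof. apply (def_bin FImp (fun a b => a -> b)); simpl; tauto. Qed.

Lemma def_iff P Q : definable P -> definable Q -> definable (fun e => P e <-> Q e).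
Proof. intros HP HQ. apply def_and; apply def_imp; assumption. Qed.

Lemma def_const (P : Prop) : definable (fun _ => P).
Proof.
  destruct (classic P) as [H|H].
  - exists (FImp FBot FBot), (fun _ => some_set).
    simpl; tauto.
  - exists FBot, (fun _ => some_set).
    simpl; tauto.
Qed.

Lemma def_not P : definable P -> definable (fun e => ~ P e).
Proof. intros H. apply def_imp; [exact H|apply def_const]. Qed.

Lemma mix_quant (a : M) (e r : env) :
  (fun k => scons a (mix e r)
     (mix (fun i => match i with O => O | S j => S (2 * j) end) (fun i => S (S (2 * i))) k))
  = mix (scons a e) r.
Proof.
  apply functional_extensionality; intros k. rewrite (mix_comp (scons a (mix e r))).
  f_equal; apply functional_extensionality; intros i.
  - destruct i as [|i]; [reflexivity|]. apply (mix_l i).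
  - apply (mix_r i).
Qed.

Lemma def_all (P : M -> env -> Prop) :
  definable (fun e => P (e 0) (tl e)) -> definable (fun e => forall a : M, P a e).
Proof.
  intros (p & r & Hp).
  exists (FAll (ren (mix (fun i => match i with O => O | S j => S (2 * j) end)
                         (fun i => S (S (2 * i)))) p)), r.
  intros e. simpl. split; intros H a; specialize (H a).
  - rewrite sat_ren, mix_quant, <- Hp. exact H.
  - rewrite sat_ren, mix_quant, <- Hp in H. exact H.
Qed.

Lemma def_ex (P : M -> env -> Prop) :
  definable (fun e => P (e 0) (tl e)) -> definable (fun e => exists a : M, P a e).
Proof.
  intros (p & r & Hp).
  exists (FEx (ren (mix (fun i => match i with O => O | S j => S (2 * j) end)
                         (fun i => S (S (2 * i)))) p)), r.
  intros e. simpl. split; intros [a H]; exists a.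
  - rewrite sat_ren, mix_quant, <- Hp. exact H.
  - rewrite sat_ren, mix_quant, <- Hp in H. exact H.
Qed.

Lemma def_ren (s : nat -> nat) (P : env -> Prop) :
  definable P -> definable (fun e => P (fun k => e (s k))).
Proof.
  intros (p & r & Hp).
  exists (ren (mix (fun i => 2 * s i) (fun i => S (2 * i))) p), r.
  intros e. rewrite sat_ren, Hp.
  replace (fun k => mix e r (mix (fun i => 2 * s i) (fun i => S (2 * i)) k))
    with (mix (fun k => e (s k)) r); [tauto|].
  apply functional_extensionality; intros k. rewrite (mix_comp (mix e r)).
  f_equal; apply functional_extensionality; intros i; symmetry.
  - apply mix_l.
  - apply mix_r.
Qed.

Lemma term_var (i : nat) : definable_term (fun e => e i).
Proof.
  exists (FEq 0 (2 * S i)), (fun _ => some_set).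
  intros e. cbn [sat]. now rewrite mix_l.
Qed.

Lemma term_const (c : M) : definable_term (fun _ => c).
Proof. exists (FEq 0 1), (fun _ => c). intros e. simpl. tauto. Qed.

Lemma term_ren (s : nat -> nat) f :
  definable_term f -> definable_term (fun e => f (fun k => e (s k))).
Proof. intros H. exact (def_ren (up s) _ H). Qed.

Lemma def_subst (Q : M -> env -> Prop) f :
  definable (fun e => Q (e 0) (tl e)) -> definable_term f -> definable (fun e => Q (f e) e).
Proof.
  intros HQ Hf.
  apply (def_ext (fun e => exists a, a = f e /\ Q a e)).
  - intros e. split; [intros (a & -> & H); exact H|intros H; now exists (f e)].
  - apply def_ex, def_and; [exact Hf|exact HQ].
Qed.

Lemma def_mem_var i j : definable (fun e => e i ∈ e j).
Proof.
  exists (FMem (2 * i) (2 * j)), (fun _ => some_set).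
  intros e. cbn [sat]. now rewrite !mix_l.
Qed.

Lemma def_ur_var i : definable (fun e => ur (e i)).
Proof.
  exists (FUr (2 * i)), (fun _ => some_set).
  intros e. cbn [sat]. now rewrite !mix_l.
Qed.

Lemma def_mem f g :
  definable_term f -> definable_term g -> definable (fun e => f e ∈ g e).
Proof.
  intros Hf Hg.
  apply (def_subst (fun a e => a ∈ g e) f); [|exact Hf].
  apply (def_subst (fun b e => e 0 ∈ b) (fun e => g (tl e))); [|exact (term_ren S _ Hg)].
  exact (def_mem_var 1 0).
Qed.

Lemma def_eq f g :
  definable_term f -> definable_term g -> definable (fun e => f e = g e).
Proof.
  intros Hf Hg.
  apply (def_subst (fun a e => a = g e) f); [exact Hg|exact Hf].
Qed.

Lemma def_ur f : definable_term f -> definable (fun e => ur (f e)).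
Proof. intros Hf. exact (def_subst (fun a _ => ur a) f (def_ur_var 0) Hf). Qed.


Create HintDb dfn.
Hint Constants Opaque : dfn.
Hint Resolve def_and def_or def_imp def_iff def_not def_mem def_eq def_ur : dfn.
Hint Extern 0 (definable (fun _ => _)) => apply def_const : dfn.
Hint Extern 0 (definable_term (fun _ => _)) => apply term_const : dfn.
Hint Extern 0 (definable_term (fun e => e ?i)) => exact (term_var i) : dfn.
Hint Extern 1 (definable (fun e => forall a : dom M, @?P a e)) =>
  apply (def_all P); cbn beta : dfn.
Hint Extern 1 (definable (fun e => exists a : dom M, @?P a e)) =>
  apply (def_ex P); cbn beta : dfn.

Hint Extern 1 (definable_term (fun e => ?f (fun k : nat => e (@?s k)))) =>
  apply (term_ren s f) : dfn.
Hint Extern 0 (definable_term ?f) => assumption : dfn.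

Ltac dfn := cbn beta; solve [typeclasses eauto with dfn nocore].

Lemma def_is_set f : definable_term f -> definable (fun e => is_set (f e)).
Proof. unfold is_set. intros; dfn. Qed.
Hint Resolve def_is_set : dfn.

Lemma def_subset f g :
  definable_term f -> definable_term g -> definable (fun e => subset (f e) (g e)).
Proof. unfold subset. intros; dfn. Qed.
Hint Resolve def_subset : dfn.

Lemma ur_empty (x y : M) : ur x -> ~ y ∈ x.
Proof. intros H. exact (proj1 HZ x H y). Qed.

Lemma mem_is_set (x y : M) : y ∈ x -> is_set x.
Proof. intros H U. exact (ur_empty x y U H). Qed.

Lemma set_ext (x y : M) :
  is_set x -> is_set y -> (forall z, z ∈ x <-> z ∈ y) -> x = y.
Proof. exact (proj1 (proj2 HZ) x y). Qed.

Lemma subset_antisym (x y : M) :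
  is_set x -> is_set y -> subset x y -> subset y x -> x = y.
Proof. intros Hx Hy H1 H2. apply set_ext; auto. intros z; split; auto. Qed.

Lemma min_mem (x : M) :
  (exists y, y ∈ x) -> exists y, y ∈ x /\ forall z, z ∈ y -> ~ z ∈ x.
Proof. exact (proj1 (proj2 (proj2 HZ)) x). Qed.

Lemma separation_semantic (P : M -> Prop) (x : M) :
  definable (fun e => P (e 0)) -> is_set x ->
  exists y, is_set y /\ forall z, z ∈ y <-> z ∈ x /\ P z.
Proof.
  intros (p & r & Hp) Hx.
  destruct (proj2 (proj2 (proj2 (proj2 (proj2 (proj2 (proj2 HZ))))))
    (ren (mix (fun _ => 0) S) p) r x Hx) as (y & Hy & H).
  exists y; split; [exact Hy|]. intros z. rewrite H, sat_ren.
  replace (fun k => scons z r (mix (fun _ => 0) S k)) with (mix (fun _ => z) r).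
  - now rewrite <- (Hp (fun _ => z)).
  - apply functional_extensionality; intros k. now rewrite (mix_comp (scons z r)).
Qed.

Lemma replacement_semantic (P : M -> M -> Prop) (x : M) :
  definable (fun e => P (e 0) (e 1)) -> is_set x ->
  (forall a, a ∈ x -> exists! b, P a b) ->
  exists y, is_set y /\ forall a b, a ∈ x -> P a b -> b ∈ y.
Proof.
  intros (p & r & Hp) Hx HP.
  pose (s := mix (fun i => match i with O => 0 | S _ => 1 end) (fun i => S (S i))).
  assert (E : forall a b, sat M (scons a (scons b r)) (ren s p) <-> P a b).
  { intros a b. rewrite sat_ren.
    replace (fun k => scons a (scons b r) (s k)) with
      (mix (fun i => match i with O => a | S _ => b end) r).
    - now rewrite <- (Hp (fun i => match i with O => a | S _ => b end)).
    - apply functional_extensionality; intros k. unfold s.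
      rewrite (mix_comp (scons a (scons b r))). f_equal.
      apply functional_extensionality; now intros [|i]. }
  destruct (proj2 HM (ren s p) r x Hx) as (y & Hy & H).
  { intros a Ha. destruct (HP a Ha) as (b & Hb & Hu).
    exists b. split; [now apply E|]. intros b' Hb'. apply Hu, E, Hb'. }
  exists y; split; [exact Hy|]. intros a b Ha Hb.
  destruct (H a Ha) as (b' & Hb' & Hs). apply E in Hs.
  destruct (HP a Ha) as (b0 & _ & Hu).
  now rewrite <- (Hu b Hb), (Hu b' Hs).
Qed.

Lemma empty_exists : exists o : M, is_set o /\ forall z, ~ z ∈ o.
Proof.
  destruct (separation_semantic (fun _ => False) some_set) as (o & Ho & H).
  - dfn.
  - exact (proj1 (proj2_sig (constructive_indefinite_description _
      has_infinity))).
  - exists o; split; [exact Ho|]. intros z Hz. exact (proj2 (proj1 (H z) Hz)).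
Qed.

(** Definite description with the empty set as junk value, so that it is total
    and preserves definability without side conditions. *)
Definition is_the (P : M -> Prop) (y : M) : Prop :=
  (P y /\ forall y', P y' -> y' = y)
  \/ (~ (exists y', P y' /\ forall y'', P y'' -> y'' = y')
      /\ is_set y /\ forall z, ~ z ∈ y).

Lemma is_the_exists (P : M -> Prop) : exists y, is_the P y.
Proof.
  destruct (classic (exists y', P y' /\ forall y'', P y'' -> y'' = y')) as [[y H]|H].
  - exists y. now left.
  - destruct empty_exists as [o Ho]. exists o. now right.
Qed.

Lemma is_the_unique (P : M -> Prop) (y y' : M) : is_the P y -> is_the P y' -> y = y'.
Proof.
  intros [[H1 H2]|(H1 & H2 & H3)] [[H4 H5]|(H4 & H5 & H6)].
  - now apply H5.
  - exfalso; eauto.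
  - exfalso; eauto.
  - apply set_ext; auto. intros z; split; intros Hz; exfalso; firstorder.
Qed.

Definition the (P : M -> Prop) : M :=
  proj1_sig (constructive_indefinite_description _ (is_the_exists P)).

Lemma the_is_the (P : M -> Prop) : is_the P (the P).
Proof. exact (proj2_sig (constructive_indefinite_description _ (is_the_exists P))). Qed.

Lemma the_eq (P : M -> Prop) (y : M) : P y -> (forall y', P y' -> y' = y) -> the P = y.
Proof. intros H H'. apply (is_the_unique P); [apply the_is_the|now left]. Qed.

Lemma term_the (P : M -> env -> Prop) :
  definable (fun e => P (e 0) (tl e)) -> definable_term (fun e => the (fun y => P y e)).
Proof.
  intros H. unfold definable_term.
  apply (def_ext (fun e => is_the (fun y => P y (tl e)) (e 0))).
  - intros e. split; [intros H1; apply (is_the_unique _ _ _ H1), the_is_the|].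
    intros ->. apply the_is_the.
  - unfold is_the.
    assert (H1 : definable (fun e => P (e 0) (fun k => e (S (S k)))))
      by exact (def_ren (fun i => match i with O => 0 | S j => S (S j) end) _ H).
    assert (H2 : definable (fun e => P (e 0) (fun k => e (S (S (S k))))))
      by exact (def_ren (fun i => match i with O => 0 | S j => S (S (S j)) end) _ H).
    assert (H3 : definable (fun e => P (e 1) (fun k => e (S (S (S k))))))
      by exact (def_ren (fun i => match i with O => 1 | S j => S (S (S j)) end) _ H).
    apply def_or; [apply def_and; [exact H|]|apply def_and; [apply def_not|dfn]].
    + apply def_all, def_imp; [exact H1|dfn].
    + apply def_ex, def_and; [exact H1|].
      apply def_all, def_imp; [exact H2|dfn].
Qed.
Hint Extern 1 (definable_term (fun e => the (fun y => @?P e y))) =>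
  apply (term_the (fun y e => P e y)); cbn beta : dfn.

(** The set [{z | P z}], or the empty set when this class is proper. *)
Definition comp (P : M -> Prop) : M := the (fun s => is_set s /\ forall z, z ∈ s <-> P z).

Lemma term_comp (P : M -> env -> Prop) :
  definable (fun e => P (e 0) (tl e)) -> definable_term (fun e => comp (fun z => P z e)).
Proof.
  intros H. unfold comp.
  apply (term_the (fun s e => is_set s /\ forall z, z ∈ s <-> P z e)).
  apply def_and; [dfn|]. apply def_all, def_iff; [dfn|].
  exact (def_ren (fun i => match i with O => 0 | S j => S (S j) end) _ H).
Qed.
Hint Extern 1 (definable_term (fun e => comp (fun y => @?P e y))) =>
  apply (term_comp (fun y e => P e y)); cbn beta : dfn.

Lemma comp_set (P : M -> Prop) : is_set (comp P).
Proof.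
  unfold comp. set (Q := fun s => _).
  destruct (the_is_the Q) as [[[H _] _]|(_ & H & _)]; exact H.
Qed.

Lemma in_comp (P : M -> Prop) (s : M) :
  definable (fun e => P (e 0)) -> (forall z, P z -> z ∈ s) ->
  forall z, z ∈ comp P <-> P z.
Proof.
  intros HP Hs.
  assert (H : exists y, is_set y /\ forall z, z ∈ y <-> P z).
  { destruct (classic (is_set s)) as [S|S].
    - destruct (separation_semantic P s HP S) as (y & Hy & H).
      exists y; split; [exact Hy|]. intros z; rewrite H. firstorder.
    - destruct empty_exists as (o & Ho & H). exists o; split; [exact Ho|].
      intros z. split; intros Hz; exfalso; [firstorder|].
      apply S. eapply mem_is_set; eauto. }
  destruct H as (y & Hy & H). unfold comp.
  rewrite (the_eq _ y); auto.
  intros y' [Hy' H']. apply set_ext; auto. intros z; rewrite H, H'; tauto.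
Qed.

Ltac use_comp s :=
  lazymatch goal with |- _ ∈ ?c <-> _ =>
    let c' := eval red in c in
    lazymatch c' with
    | comp ?P => refine (in_comp P s _ _ _)
    | _ => lazymatch c with comp ?P => refine (in_comp P s _ _ _) end
    end
  end.

Definition upair (a b : M) : M := comp (fun z => z = a \/ z = b).

Lemma in_upair (a b z : M) : z ∈ upair a b <-> z = a \/ z = b.
Proof.
  destruct (proj1 (proj2 (proj2 (proj2 HZ))) a b) as (p & Hp & H).
  use_comp p; [dfn|]. intros y. apply H.
Qed.

Lemma term_upair f g :
  definable_term f -> definable_term g -> definable_term (fun e => upair (f e) (g e)).
Proof. unfold upair. intros; dfn. Qed.
Hint Resolve term_upair : dfn.

Definition opair (a b : M) : M := upair (upair a a) (upair a b).

Lemma term_opair f g :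
  definable_term f -> definable_term g -> definable_term (fun e => opair (f e) (g e)).
Proof. unfold opair. intros; dfn. Qed.
Hint Resolve term_opair : dfn.

Lemma is_upair_iff (p a b : M) : is_upair p a b <-> p = upair a b.
Proof.
  split.
  - intros [Hp H]. apply set_ext; [exact Hp|apply comp_set|].
    intros z. now rewrite H, in_upair.
  - intros ->. split; [apply comp_set|]. intros z; apply in_upair.
Qed.

Lemma is_opair_iff (p a b : M) : is_opair p a b <-> p = opair a b.
Proof.
  unfold is_opair. split.
  - intros (u & v & Hu & Hv & Hp). apply is_upair_iff in Hu, Hv, Hp. now subst.
  - intros ->. exists (upair a a), (upair a b). rewrite !is_upair_iff. auto.
Qed.

Lemma opair_inj (a b c d : M) : opair a b = opair c d -> a = c /\ b = d.
Proof.
  intros E.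
  assert (H : forall z, z ∈ opair a b <-> z ∈ opair c d) by (intros; rewrite E; tauto).
  unfold opair in H.
  assert (S : forall x y z, upair x y = upair z z -> x = z /\ y = z).
  { intros x y z E'. split.
    - assert (K : x ∈ upair z z) by (rewrite <- E', in_upair; auto).
      rewrite in_upair in K; tauto.
    - assert (K : y ∈ upair z z) by (rewrite <- E', in_upair; auto).
      rewrite in_upair in K; tauto. }
  assert (A : a = c).
  { destruct (proj1 (in_upair _ _ _) (proj1 (H _) (proj2 (in_upair _ _ _) (or_introl eq_refl))))
      as [K|K].
    - now apply S in K.
    - symmetry in K. apply S in K. symmetry; tauto. }
  split; [exact A|]. subst c.
  destruct (proj1 (in_upair _ _ _) (proj1 (H _) (proj2 (in_upair _ _ _) (or_intror eq_refl))))
    as [K|K].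
  - apply S in K as [_ ->].
    destruct (proj1 (in_upair _ _ _) (proj2 (H _) (proj2 (in_upair _ _ _) (or_intror eq_refl))))
      as [K|K]; apply S in K; symmetry; tauto.
  - assert (B : b ∈ upair a d) by (rewrite <- K, in_upair; auto).
    assert (D : d ∈ upair a b) by (rewrite K, in_upair; auto).
    rewrite in_upair in B, D. destruct B, D; congruence.
Qed.

Lemma related_iff (r x y : M) : related r x y <-> opair x y ∈ r.
Proof.
  unfold related. split.
  - intros (p & Hp & E). apply is_opair_iff in E. now subst.
  - intros H. exists (opair x y). now rewrite is_opair_iff.
Qed.

Lemma def_related f g h : definable_term f -> definable_term g -> definable_term h ->
  definable (fun e => related (f e) (g e) (h e)).
Proof.
  intros. apply (def_ext (fun e => opair (g e) (h e) ∈ f e)); [|dfn].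
  intros e. now rewrite related_iff.
Qed.
Hint Resolve def_related : dfn.

Definition sUnion (x : M) : M := comp (fun z => exists y, y ∈ x /\ z ∈ y).

Lemma in_sUnion (x z : M) : z ∈ sUnion x <-> exists y, y ∈ x /\ z ∈ y.
Proof.
  destruct (classic (is_set x)) as [S|S].
  - destruct (proj1 (proj2 (proj2 (proj2 (proj2 HZ)))) x S) as (u & Hu & H).
    use_comp u; [dfn|]. intros y. apply H.
  - use_comp x; [dfn|]. intros y (w & Hw & _).
    exfalso. exact (S (mem_is_set _ _ Hw)).
Qed.

Lemma term_sUnion f : definable_term f -> definable_term (fun e => sUnion (f e)).
Proof. unfold sUnion. intros; dfn. Qed.
Hint Resolve term_sUnion : dfn.

Definition power (x : M) : M := comp (fun z => is_set z /\ subset z x).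

Lemma in_power (x z : M) : z ∈ power x <-> is_set z /\ subset z x.
Proof.
  destruct (classic (is_set x)) as [S|S].
  - destruct (proj1 (proj2 (proj2 (proj2 (proj2 (proj2 HZ))))) x S) as (u & Hu & H).
    use_comp u; [dfn|]. intros y. apply H.
  - destruct empty_exists as (o & Ho & H).
    use_comp (upair o o); [dfn|]. intros y (Hy & Hs).
    apply in_upair. left. apply set_ext; auto. intros w; split; intros Hw; exfalso.
    + exact (S (mem_is_set _ _ (Hs _ Hw))).
    + exact (H _ Hw).
Qed.

Lemma term_power f : definable_term f -> definable_term (fun e => power (f e)).
Proof. unfold power. intros; dfn. Qed.
Hint Resolve term_power : dfn.

Definition cup (a b : M) : M := sUnion (upair a b).

Lemma in_cup (a b z : M) : z ∈ cup a b <-> z ∈ a \/ z ∈ b.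
Proof.
  unfold cup. rewrite in_sUnion. setoid_rewrite in_upair.
  split; [intros (y & [->| ->] & H); auto|intros [H|H]; eauto].
Qed.

Lemma term_cup f g :
  definable_term f -> definable_term g -> definable_term (fun e => cup (f e) (g e)).
Proof. unfold cup. intros; dfn. Qed.
Hint Resolve term_cup : dfn.

Definition diff (a b : M) : M := comp (fun z => z ∈ a /\ ~ z ∈ b).

Lemma in_diff (a b z : M) : z ∈ diff a b <-> z ∈ a /\ ~ z ∈ b.
Proof. use_comp a; [dfn|tauto]. Qed.

Lemma term_diff f g :
  definable_term f -> definable_term g -> definable_term (fun e => diff (f e) (g e)).
Proof. unfold diff. intros; dfn. Qed.
Hint Resolve term_diff : dfn.

Definition sep (x : M) (P : M -> Prop) : M := comp (fun z => z ∈ x /\ P z).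

Lemma in_sep (x : M) (P : M -> Prop) (z : M) :
  definable (fun e => P (e 0)) -> (z ∈ sep x P <-> z ∈ x /\ P z).
Proof. intros H. use_comp x; [dfn|tauto]. Qed.
Hint Extern 1 (definable_term (fun e => sep _ _)) => unfold sep : dfn.

Definition definable_fun (h : M -> M) : Prop :=
  forall f, definable_term f -> definable_term (fun e => h (f e)).

Hint Extern 1 => match goal with
  | H : definable_fun ?h |- definable_term (fun e => ?h _) => apply H
  end : dfn.

Definition image (h : M -> M) (x : M) : M := comp (fun y => exists z, z ∈ x /\ y = h z).

Lemma in_image (h : M -> M) (x y : M) :
  definable_fun h -> (y ∈ image h x <-> exists z, z ∈ x /\ y = h z).
Proof.
  intros H.
  destruct (classic (is_set x)) as [S|S].
  - destruct (replacement_semantic (fun a b => b = h a) x) as (s & Hs & H').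
    + dfn.
    + exact S.
    + intros a _. exists (h a). split; auto.
    + use_comp s; [dfn|].
      intros z (w & Hw & E). eauto.
  - use_comp x; [dfn|].
    intros w (z & Hz & _). exfalso. exact (S (mem_is_set _ _ Hz)).
Qed.
Hint Extern 1 (definable_term (fun e => image _ _)) => unfold image : dfn.

(** * Recursion *)

Section Recursion.

Context (R : M -> M -> Prop) (F : M -> M -> M -> M).
Context (HR : forall f g, definable_term f -> definable_term g ->
  definable (fun e => R (f e) (g e))).
Context (HF : forall f g h, definable_term f -> definable_term g -> definable_term h ->
  definable_term (fun e => F (f e) (g e) (h e))).

Definition R_closed (d : M) : Prop := forall y z, z ∈ d -> R y z -> y ∈ d.

Context (R_min : forall s, (exists y, y ∈ s) ->
  exists y, y ∈ s /\ forall z, z ∈ s -> ~ R z y).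
Context (R_hull : forall x, exists d, x ∈ d /\ R_closed d).

Lemma R_ind (P : M -> Prop) : definable (fun e => P (e 0)) ->
  (forall x, (forall y, R y x -> P y) -> P x) -> forall x, P x.
Proof.
  intros HP H x. apply NNPP. intros N.
  destruct (R_hull x) as (d & Hx & Hd).
  assert (Hs : forall z, z ∈ sep d (fun z => ~ P z) <-> z ∈ d /\ ~ P z)
    by (intros; apply in_sep; dfn).
  destruct (R_min (sep d (fun z => ~ P z))) as (y & Hy & Hm).
  - exists x. now apply Hs.
  - apply Hs in Hy as [Hy Ny]. apply Ny, H. intros z Hz. apply NNPP. intros Nz.
    apply (Hm z); [apply Hs; split|]; auto. eapply Hd; eauto.
Qed.

Lemma def_R_closed f : definable_term f -> definable (fun e => R_closed (f e)).
Proof. unfold R_closed. intros; dfn. Qed.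
Hint Resolve def_R_closed : dfn.

Definition values (h x : M) : M := comp (fun v => exists y, R y x /\ opair y v ∈ h).

Lemma term_values f g :
  definable_term f -> definable_term g -> definable_term (fun e => values (f e) (g e)).
Proof. unfold values. intros; dfn. Qed.
Hint Resolve term_values : dfn.

Lemma in_values (h x v : M) : v ∈ values h x <-> exists y, R y x /\ opair y v ∈ h.
Proof.
  use_comp (sUnion (sUnion h)); [dfn|]. intros w (y & _ & H).
  apply in_sUnion. exists (upair y w). split.
  - apply in_sUnion. exists (opair y w). split; [exact H|].
    apply in_upair; auto.
  - apply in_upair; auto.
Qed.

Definition approx (c d h : M) : Prop :=
  R_closed d /\ forall x v, x ∈ d -> (opair x v ∈ h <-> v = F c x (values h x)).

Lemma def_approx f g h : definable_term f -> definable_term g -> definable_term h ->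
  definable (fun e => approx (f e) (g e) (h e)).
Proof. unfold approx. intros; dfn. Qed.
Hint Resolve def_approx : dfn.

Definition rec (c x : M) : M :=
  the (fun v => exists d h, approx c d h /\ x ∈ d /\ opair x v ∈ h).

Lemma term_rec f g :
  definable_term f -> definable_term g -> definable_term (fun e => rec (f e) (g e)).
Proof. unfold rec. intros; dfn. Qed.
Hint Resolve term_rec : dfn.

Definition rec_values (c x : M) : M := comp (fun v => exists y, R y x /\ v = rec c y).

Lemma term_rec_values f g :
  definable_term f -> definable_term g -> definable_term (fun e => rec_values (f e) (g e)).
Proof. unfold rec_values. intros; dfn. Qed.
Hint Resolve term_rec_values : dfn.

Lemma in_rec_values (c x v : M) : v ∈ rec_values c x <-> exists y, R y x /\ v = rec c y.
Proof.
  destruct (R_hull x) as (d & Hx & Hd).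
  use_comp (image (rec c) d); [dfn|]. intros w (y & Hy & E).
  apply in_image; [intros f Hf; dfn|]. exists y; eauto.
Qed.

Lemma approx_unique (c d h d' h' : M) : approx c d h -> approx c d' h' ->
  forall x, x ∈ d -> x ∈ d' -> forall v, opair x v ∈ h <-> opair x v ∈ h'.
Proof.
  intros [Hd H] [Hd' H'].
  apply (R_ind (fun x => x ∈ d -> x ∈ d' -> forall v, opair x v ∈ h <-> opair x v ∈ h')).
  { dfn. }
  intros x IH Hx Hx' v. rewrite H, H' by assumption.
  replace (values h' x) with (values h x); [tauto|].
  apply set_ext; try apply comp_set. intros z. rewrite !in_values.
  split; intros (y & Hy & Hz); exists y; (split; [exact Hy|]);
    apply (IH y Hy); eauto.
Qed.

Lemma approx_rec (c d h : M) : approx c d h ->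
  forall x v, x ∈ d -> (opair x v ∈ h <-> v = rec c x).
Proof.
  intros Ha x v Hx.
  assert (E : rec c x = F c x (values h x)).
  { apply the_eq.
    - exists d, h. split; [exact Ha|split; [exact Hx|]]. now apply Ha.
    - intros v' (d' & h' & Ha' & Hx' & Hv').
      apply (approx_unique _ _ _ _ _ Ha' Ha x Hx' Hx) in Hv'. now apply Ha in Hv'. }
  rewrite E. now apply Ha.
Qed.

Lemma approx_values (c d h x : M) : approx c d h -> x ∈ d -> values h x = rec_values c x.
Proof.
  intros Ha Hx. apply set_ext; try apply comp_set. intros z.
  rewrite in_values, in_rec_values.
  split; intros (y & Hy & Hz); exists y; (split; [exact Hy|]);
    apply (approx_rec _ _ _ Ha); auto; eapply Ha; eauto.
Qed.

Lemma approx_exists (c x : M) : exists d h, approx c d h /\ x ∈ d.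
Proof.
  revert x. apply R_ind; [dfn|]. intros x IH.
  destruct (R_hull x) as (s & Hx & Hs).
  pose (good := fun z => exists d h, approx c d h /\ z ∈ d).
  pose (d := sep s (fun y => forall z, R z y -> good z)).
  assert (Hd : forall y, y ∈ d <-> y ∈ s /\ forall z, R z y -> good z)
    by (intros; apply in_sep; unfold good; dfn).
  assert (dc : R_closed d).
  { intros y z Hz Hy. apply Hd in Hz as [Hz Gz]. apply Hd. split; [eauto|].
    intros w Hw. destruct (Gz y Hy) as (d' & h' & Ha & Hy').
    exists d', h'. split; [exact Ha|]. eapply Ha; eauto. }
  pose (h := image (fun y => opair y (F c y (rec_values c y))) d).
  assert (Hh : forall y v, y ∈ d -> (opair y v ∈ h <-> v = F c y (rec_values c y))).
  { intros y v Hy. unfold h. rewrite in_image by (intros f Hf; dfn). split.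
    - intros (z & _ & E). apply opair_inj in E as [-> ->]. reflexivity.
    - intros ->. eauto. }
  exists d, h. split; [split; [exact dc|]|apply Hd; auto].
  intros y v Hy. rewrite Hh by exact Hy.
  replace (values h y) with (rec_values c y); [tauto|].
  apply set_ext; try apply comp_set. intros w.
  rewrite in_values, in_rec_values.
  split; intros (z & Hz & Hw); exists z; (split; [exact Hz|]);
    destruct (proj2 (proj1 (Hd y) Hy) z Hz) as (d' & h' & Ha & Hz').
  - rewrite Hh by eauto. subst w.
    rewrite <- (approx_values c d' h') by assumption.
    apply Ha; auto. now apply (approx_rec _ _ _ Ha).
  - rewrite Hh in Hw by eauto.
    rewrite <- (approx_values c d' h') in Hw by assumption.
    apply Ha in Hw; auto. now apply (approx_rec _ _ _ Ha) in Hw.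
Qed.

Lemma rec_eq (c x : M) : rec c x = F c x (rec_values c x).
Proof.
  destruct (approx_exists c x) as (d & h & Ha & Hx).
  rewrite <- (approx_values c d h) by assumption.
  apply Ha; auto. now apply (approx_rec _ _ _ Ha).
Qed.

End Recursion.

Definition empty : M := comp (fun _ => False).

Lemma not_in_empty (x : M) : ~ x ∈ empty.
Proof.
  assert (H : x ∈ empty <-> False) by (use_comp empty; [dfn|tauto]). tauto.
Qed.

Definition succ (x : M) : M := cup x (upair x x).

Lemma in_succ (x z : M) : z ∈ succ x <-> z ∈ x \/ z = x.
Proof. unfold succ. rewrite in_cup, in_upair. tauto. Qed.

Lemma term_succ f : definable_term f -> definable_term (fun e => succ (f e)).
Proof. unfold succ. intros; dfn. Qed.
Hint Resolve term_succ : dfn.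

Lemma mem_asym (x y : M) : x ∈ y -> y ∈ x -> False.
Proof.
  intros H H'. destruct (min_mem (upair x y)) as (z & Hz & Hm).
  - exists x. apply in_upair; auto.
  - apply in_upair in Hz as [-> | ->].
    + apply (Hm y H'). apply in_upair; auto.
    + apply (Hm x H). apply in_upair; auto.
Qed.

Lemma succ_inj (x y : M) : succ x = succ y -> x = y.
Proof.
  intros E.
  assert (H : x ∈ succ y) by (rewrite <- E, in_succ; auto).
  assert (H' : y ∈ succ x) by (rewrite E, in_succ; auto).
  rewrite in_succ in H, H'. destruct H, H'; auto. exfalso; eapply mem_asym; eauto.
Qed.

Lemma succ_not_empty (x : M) : succ x <> empty.
Proof. intros E. apply (not_in_empty x). rewrite <- E, in_succ. auto. Qed.

Definition inductive (i : M) : Prop := empty ∈ i /\ forall x, x ∈ i -> succ x ∈ i.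

Lemma inductive_exists : exists i, inductive i.
Proof.
  destruct has_infinity
    as (w & _ & (o & Ho & So & Eo) & Hs).
  exists w. split.
  - replace empty with o; [exact Ho|].
    apply set_ext; [exact So|apply comp_set|].
    intros z; split; intros Hz; exfalso; [eapply Eo|eapply not_in_empty]; eauto.
  - intros x Hx. destruct (Hs x Hx) as (s & Hs1 & Hs2 & Hs3).
    replace (succ x) with s; [exact Hs1|].
    apply set_ext; [exact Hs2|apply comp_set|].
    intros z. now rewrite Hs3, in_succ.
Qed.

Definition omega : M := comp (fun n => forall i, inductive i -> n ∈ i).

Lemma in_omega (n : M) : n ∈ omega <-> forall i, inductive i -> n ∈ i.
Proof.
  destruct inductive_exists as [w Hw].
  use_comp w; [unfold inductive; dfn|auto].
Qed.

Lemma omega_inductive : inductive omega.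
Proof.
  split.
  - apply in_omega. intros i Hi; apply Hi.
  - intros x Hx. rewrite in_omega in *. intros i Hi. apply Hi, Hx, Hi.
Qed.

Lemma omega_ind (P : M -> Prop) : definable (fun e => P (e 0)) ->
  P empty -> (forall n, n ∈ omega -> P n -> P (succ n)) ->
  forall n, n ∈ omega -> P n.
Proof.
  intros HP H0 HS n Hn.
  assert (Hs : forall z, z ∈ sep omega P <-> z ∈ omega /\ P z)
    by (intros; apply in_sep; dfn).
  enough (K : n ∈ sep omega P) by (apply Hs in K; tauto).
  apply (proj1 (in_omega n) Hn). split.
  - apply Hs. split; [apply omega_inductive|exact H0].
  - intros x Hx. apply Hs in Hx as [H1 H2]. apply Hs. split; [|auto].
    now apply omega_inductive.
Qed.

Ltac omega_induction :=
  match goal with |- forall n, n ∈ omega -> @?P n =>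
    apply (omega_ind P); cbn beta; [dfn| |] end.

Lemma omega_trichotomy (n : M) : n ∈ omega ->
  forall m, m ∈ omega -> m ∈ n \/ m = n \/ n ∈ m.
Proof.
  assert (Z : forall m, m ∈ omega -> m = empty \/ empty ∈ m).
  { omega_induction; [auto|]. intros m _ [->|H]; right; apply in_succ; auto. }
  assert (S : forall n, n ∈ omega -> forall m, m ∈ omega -> n ∈ m -> succ n = m \/ succ n ∈ m).
  { clear n. intros n Hn. omega_induction.
    - intros H. exfalso. eapply not_in_empty; eauto.
    - intros m _ IH H. apply in_succ in H as [H| ->]; [|auto].
      right. apply in_succ. destruct (IH H); auto. }
  revert n. omega_induction.
  - intros m Hm. destruct (Z m Hm); auto.
  - intros n Hn IH m Hm. rewrite in_succ.
    destruct (IH m Hm) as [H|[H|H]]; auto.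
    destruct (S n Hn m Hm H); auto.
Qed.

Section Iteration.

Context (x0 : M) (F : M -> M) (HF : definable_fun F).

Definition pred_rel (n m : M) : Prop := n ∈ omega /\ m = succ n.

Definition iter_step (c n s : M) : M :=
  the (fun v => (~ (exists u, u ∈ s) /\ v = x0) \/ (exists u, u ∈ s /\ v = F u)).

Definition iter (n : M) : M := rec pred_rel iter_step empty n.

Lemma def_pred_rel f g :
  definable_term f -> definable_term g -> definable (fun e => pred_rel (f e) (g e)).
Proof. unfold pred_rel. intros; dfn. Qed.

Lemma term_iter_step f g h : definable_term f -> definable_term g -> definable_term h ->
  definable_term (fun e => iter_step (f e) (g e) (h e)).
Proof. unfold iter_step. intros; dfn. Qed.

Lemma term_iter f : definable_term f -> definable_term (fun e => iter (f e)).
Proof.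
  intros. unfold iter.
  apply (term_rec _ _ def_pred_rel term_iter_step); dfn.
Qed.

Lemma pred_rel_min s :
  (exists y, y ∈ s) -> exists y, y ∈ s /\ forall z, z ∈ s -> ~ pred_rel z y.
Proof.
  intros H. destruct (min_mem s H) as (y & Hy & Hm). exists y; split; [exact Hy|].
  intros z Hz [_ ->]. apply (Hm z); [apply in_succ; auto|exact Hz].
Qed.

Lemma pred_rel_hull x : exists d, x ∈ d /\ R_closed pred_rel d.
Proof.
  exists (cup omega (upair x x)). split.
  - apply in_cup. right. apply in_upair; auto.
  - intros y z _ [Hy _]. apply in_cup; auto.
Qed.

Lemma iter_values (n v : M) :
  v ∈ rec_values pred_rel iter_step empty n <-> exists m, pred_rel m n /\ v = iter m.
Proof.
  apply (in_rec_values _ _ def_pred_rel term_iter_step pred_rel_hull).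
Qed.

Lemma iter_eq (n : M) : iter n = iter_step empty n (rec_values pred_rel iter_step empty n).
Proof.
  exact (rec_eq _ _ def_pred_rel term_iter_step pred_rel_min pred_rel_hull empty n).
Qed.

Lemma iter_empty : iter empty = x0.
Proof.
  rewrite iter_eq. apply the_eq.
  - left. split; [|reflexivity]. intros (u & Hu). apply iter_values in Hu as (m & [_ E] & _).
    symmetry in E. exact (succ_not_empty _ E).
  - intros y [[_ H]|(u & Hu & _)]; [exact H|].
    apply iter_values in Hu as (m & [_ E] & _).
    symmetry in E. destruct (succ_not_empty _ E).
Qed.

Lemma iter_succ (n : M) : n ∈ omega -> iter (succ n) = F (iter n).
Proof.
  intros Hn. rewrite iter_eq. apply the_eq.
  - right. exists (iter n). split; [|reflexivity].
    apply iter_values. exists n. repeat split; auto.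
  - intros y [[H _]|(u & Hu & ->)].
    + destruct H. exists (iter n). apply iter_values. exists n. repeat split; auto.
    + apply iter_values in Hu as (m & [_ E] & ->). now rewrite (succ_inj _ _ E).
Qed.

End Iteration.

Lemma definable_iter x0 F : definable_fun F -> definable_fun (iter x0 F).
Proof. intros HF f Hf. now apply term_iter. Qed.

Lemma transitive_superset (x : M) : exists t, transitive_set t /\ x ∈ t.
Proof.
  pose (u := iter (upair x x) sUnion).
  assert (HU : definable_fun sUnion) by (intros f Hf; dfn).
  assert (Hu : definable_fun u) by now apply definable_iter.
  exists (sUnion (image u omega)). repeat split.
  - apply comp_set.
  - intros y z Hy Hz. apply in_sUnion in Hy as (w & Hw & Hy).
    apply in_image in Hw as (n & Hn & ->); [|exact Hu].
    apply in_sUnion. exists (u (succ n)). split.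
    + apply in_image; [exact Hu|]. exists (succ n). split; [|reflexivity].
      now apply omega_inductive.
    + unfold u. rewrite iter_succ by assumption. apply in_sUnion. eauto.
  - apply in_sUnion. exists (u empty). split.
    + apply in_image; [exact Hu|]. exists empty. split; [|reflexivity].
      apply omega_inductive.
    + unfold u. rewrite iter_empty by assumption. apply in_upair; auto.
Qed.

Lemma mem_hull x : exists d, x ∈ d /\ R_closed (@mem M) d.
Proof.
  destruct (transitive_superset x) as (t & [_ Ht] & Hx).
  exists t; split; [exact Hx|]. intros y z; apply Ht.
Qed.

Lemma mem_min (s : M) :
  (exists y, y ∈ s) -> exists y, y ∈ s /\ forall z, z ∈ s -> ~ z ∈ (y : M).
Proof. intros H. destruct (min_mem s H) as (y & Hy & Hm). exists y; firstorder. Qed.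

Lemma mem_ind (P : M -> Prop) : definable (fun e => P (e 0)) ->
  (forall x, (forall y, y ∈ x -> P y) -> P x) -> forall x, P x.
Proof. exact (R_ind (@mem M) mem_min mem_hull P). Qed.

Ltac mem_induction :=
  match goal with |- forall x, @?P x => apply (mem_ind P); cbn beta; [dfn|] end.

(** * The cumulative hierarchy over a set of urelements *)

Definition V_step (A x s : M) : M := cup A (sUnion (image power s)).

(** [V A x] is the level of the cumulative hierarchy over [A] whose index is the
    rank of [x]. Indexing by arbitrary sets makes ordinals unnecessary. *)
Definition V (A x : M) : M := rec mem V_step A x.

Lemma definable_power : definable_fun power.
Proof. intros f Hf; dfn. Qed.

Lemma def_mem_rel f g :
  definable_term f -> definable_term g -> definable (fun e => f e ∈ g e).
Proof. intros; dfn. Qed.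

Lemma term_V_step f g h : definable_term f -> definable_term g -> definable_term h ->
  definable_term (fun e => V_step (f e) (g e) (h e)).
Proof. unfold V_step. intros; dfn. Qed.

Lemma term_V f g :
  definable_term f -> definable_term g -> definable_term (fun e => V (f e) (g e)).
Proof. exact (term_rec _ _ def_mem_rel term_V_step f g). Qed.
Hint Resolve term_V : dfn.

Lemma in_V (A x u : M) :
  u ∈ V A x <-> u ∈ A \/ exists y, y ∈ x /\ is_set u /\ subset u (V A y).
Proof.
  unfold V at 1. rewrite (rec_eq _ _ def_mem_rel term_V_step mem_min mem_hull).
  unfold V_step. rewrite in_cup, in_sUnion.
  split; (intros [H|H]; [now left|right]).
  - destruct H as (p & Hp & Hu). apply (in_image _ _ _ definable_power) in Hp as (v & Hv & ->).
    apply (in_rec_values _ _ def_mem_rel term_V_step mem_hull) in Hv as (y & Hy & ->).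
    apply in_power in Hu. now exists y.
  - destruct H as (y & Hy & Hu). exists (power (V A y)). split; [|now apply in_power].
    apply (in_image _ _ _ definable_power). exists (V A y). split; [|reflexivity].
    apply (in_rec_values _ _ def_mem_rel term_V_step mem_hull). now exists y.
Qed.

Lemma V_set (A x : M) : is_set (V A x).
Proof.
  unfold V. rewrite (rec_eq _ _ def_mem_rel term_V_step mem_min mem_hull). apply comp_set.
Qed.

Lemma V_transitive (A : M) : ur_set A -> forall x y z, y ∈ V A x -> z ∈ y -> z ∈ V A x.
Proof.
  intros [_ HA]. mem_induction. intros x IH y z Hy Hz.
  apply in_V in Hy as [Hy|(x' & Hx & Sy & Hy)].
  - destruct (ur_empty _ _ (HA _ Hy) Hz).
  - apply Hy in Hz. apply in_V.
    destruct (proj1 (in_V A x' z) Hz) as [H|(x'' & _ & Sz & _)]; [now left|right].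
    exists x'. split; [exact Hx|split; [exact Sz|]].
    intros w Hw. exact (IH x' Hx z w Hz Hw).
Qed.

Lemma V_supertransitive (A : M) : ur_set A ->
  forall x u v, v ∈ V A x -> is_set v -> is_set u -> subset u v -> u ∈ V A x.
Proof.
  intros [_ HA] x u v Hv Sv Su Huv. apply in_V in Hv as [Hv|(y & Hy & _ & Hv)].
  - destruct (Sv (HA _ Hv)).
  - apply in_V. right. exists y. split; [exact Hy|split; [exact Su|]].
    intros z Hz; auto.
Qed.

Lemma V_compare (A : M) : ur_set A ->
  forall x y, V A x ∈ V A y \/ subset (V A y) (V A x).
Proof.
  intros HA.
  assert (G : forall x y, (exists x', x' ∈ x /\ subset (V A y) (V A x')) -> V A y ∈ V A x).
  { intros x y (x' & Hx & H). apply in_V. right. exists x'. auto using V_set. }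
  assert (L : forall x y, (forall x', x' ∈ x -> V A x' ∈ V A y) -> subset (V A x) (V A y)).
  { intros x y H u Hu. apply in_V in Hu as [Hu|(x' & Hx & Su & Hu)].
    - apply in_V. now left.
    - apply (V_supertransitive A HA y u (V A x')); auto using V_set. }
  mem_induction. intros x IH.
  assert (C : forall y, V A y ∈ V A x \/ subset (V A x) (V A y)).
  { intros y. destruct (classic (exists x', x' ∈ x /\ subset (V A y) (V A x'))) as [E|E].
    - left. now apply G.
    - right. apply L. intros x' Hx. destruct (IH x' Hx y); [assumption|].
      destruct E; eauto. }
  intros y. destruct (classic (exists y', y' ∈ y /\ subset (V A x) (V A y'))) as [E|E].
  - left. now apply G.
  - right. apply L. intros y' Hy. destruct (C y'); [assumption|]. destruct E; eauto.
Qed.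

(** [over A y]: all urelements in the transitive closure of [{y}] belong to [A]. *)
Definition over (A y : M) : Prop := y ∈ A \/ (is_set y /\ subset y (V A y)).

Lemma def_over f g :
  definable_term f -> definable_term g -> definable (fun e => over (f e) (g e)).
Proof. unfold over. intros; dfn. Qed.
Hint Resolve def_over : dfn.

Lemma over_in_V (A y : M) : over A y -> y ∈ V A (upair y y).
Proof.
  intros [H|H]; apply in_V; [now left|right].
  exists y. split; [apply in_upair; auto|exact H].
Qed.

Lemma over_subset_V (A y : M) : (forall z, z ∈ y -> over A z) -> subset y (V A y).
Proof.
  intros H z Hz. destruct (H z Hz) as [Hz'|Hz']; apply in_V; [now left|right]. eauto.
Qed.

Lemma V_over (A : M) : forall x u, u ∈ V A x -> over A u.
Proof.
  mem_induction. intros x IH u Hu. apply in_V in Hu as [Hu|(y & Hy & Su & Hu)]; [now left|].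
  right. split; [exact Su|]. apply over_subset_V. intros z Hz. apply (IH y Hy). auto.
Qed.

Lemma over_iff (A y : M) :
  over A y <-> y ∈ A \/ (is_set y /\ forall z, z ∈ y -> over A z).
Proof.
  split; (intros [H|[S H]]; [now left|right; split; [exact S|]]).
  - intros z Hz. eapply V_over; eauto.
  - now apply over_subset_V.
Qed.

Lemma over_subset (A A' : M) : subset A A' -> forall y, over A y -> over A' y.
Proof.
  intros HA. mem_induction. intros y IH H.
  apply over_iff. apply over_iff in H as [H|[S H]]; [left; auto|right; auto].
Qed.

Lemma over_exists (x : M) : exists A, ur_set A /\ over A x.
Proof.
  destruct (transitive_superset x) as (t & [_ Ht] & Hx).
  assert (HA : forall z, z ∈ sep t ur <-> z ∈ t /\ ur z) by (intros; apply in_sep; dfn).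
  exists (sep t ur). split.
  - split; [apply comp_set|]. intros z Hz. now apply HA in Hz.
  - revert x Hx. mem_induction. intros y IH Hy. apply over_iff.
    destruct (classic (ur y)) as [U|S]; [left; now apply HA|right].
    split; [exact S|]. intros z Hz. eauto.
Qed.

Lemma V_least (A : M) (Q : M -> Prop) : ur_set A -> definable (fun e => Q (e 0)) ->
  (exists z, Q (V A z)) ->
  exists z, Q (V A z) /\ forall z', Q (V A z') -> subset (V A z) (V A z').
Proof.
  intros HA HQ [z Hz]. apply NNPP. intros N.
  enough (K : forall v z, v = V A z -> ~ Q v) by (apply (K _ z eq_refl Hz)).
  clear z Hz.
  assert (HQ' : forall f, definable_term f -> definable (fun e => Q (f e))).
  { intros f Hf. exact (def_subst (fun a _ => Q a) f (def_ren (fun _ => 0) _ HQ) Hf). }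
  mem_induction. intros v IH z -> Hz. apply N. exists z. split; [exact Hz|].
  intros z' Hz'. destruct (V_compare A HA z' z) as [H|H]; [|exact H].
  destruct (IH _ H z' eq_refl Hz').
Qed.

Lemma collection (A X : M) (P : M -> M -> Prop) : ur_set A ->
  (forall f g, definable_term f -> definable_term g -> definable (fun e => P (f e) (g e))) ->
  exists W, is_set W /\ (forall y, y ∈ W -> over A y) /\
    forall a y, a ∈ X -> over A y -> P a y -> exists y', y' ∈ W /\ P a y'.
Proof.
  intros HA HP.
  (* the least level over [A] that contains a witness for [a] *)
  pose (lev := fun a => the (fun v => (exists z, v = V A z) /\ (exists y, y ∈ v /\ P a y) /\
    forall z', (exists y, y ∈ V A z' /\ P a y) -> subset v (V A z'))).
  assert (Hl : definable_fun lev) by (intros f Hf; unfold lev; dfn).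
  exists (sep (sUnion (image lev X)) (over A)).
  assert (Hs : forall y, y ∈ sep (sUnion (image lev X)) (over A) <->
    y ∈ sUnion (image lev X) /\ over A y) by (intros; apply in_sep; dfn).
  split; [apply comp_set|split; [intros y Hy; now apply Hs in Hy|]].
  intros a y Ha Hy Py.
  destruct (V_least A (fun v => exists y, y ∈ v /\ P a y)) as (z & (y' & Hy' & Py') & Hm).
  - exact HA.
  - dfn.
  - exists (upair y y), y. auto using over_in_V.
  - assert (E : lev a = V A z).
    { apply the_eq.
      - split; [now exists z|split; [now exists y'|exact Hm]].
      - intros v ((z' & ->) & Hv & Hm').
        apply subset_antisym; auto using V_set. apply Hm'. now exists y'. }
    exists y'. split; [|exact Py']. apply Hs. split; [|now apply V_over in Hy'].
    apply in_sUnion. exists (V A z). split; [|exact Hy'].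
    rewrite <- E. apply in_image; [exact Hl|]. now exists a.
Qed.

(** * Injections and automorphisms *)

Definition inj (A B : M) : Prop :=
  exists h, definable_fun h /\ (forall x, x ∈ A -> h x ∈ B) /\
    forall x x', x ∈ A -> x' ∈ A -> h x = h x' -> x = x'.

Definition graph (h : M -> M) (A : M) : M := image (fun x => opair x (h x)) A.

Lemma related_graph (h : M -> M) (A x y : M) : definable_fun h ->
  (related (graph h A) x y <-> x ∈ A /\ y = h x).
Proof.
  intros Hh. rewrite related_iff. unfold graph.
  rewrite in_image by (intros f Hf; dfn). split.
  - intros (z & Hz & E). apply opair_inj in E as [-> ->]. auto.
  - intros [Hx ->]. now exists x.
Qed.

Lemma graph_injection (h : M -> M) (A B : M) : definable_fun h ->
  (forall x, x ∈ A -> h x ∈ B) ->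
  (forall x x', x ∈ A -> x' ∈ A -> h x = h x' -> x = x') ->
  is_injection (graph h A) A B.
Proof.
  intros Hh HB Hi. split; [split; [apply comp_set|split]|].
  - intros p Hp. unfold graph in Hp. apply in_image in Hp as (x & Hx & ->).
    + exists x, (h x). rewrite is_opair_iff. auto.
    + intros f Hf; dfn.
  - intros x Hx. exists (h x). split.
    + now apply related_graph.
    + intros y Hy. apply related_graph in Hy as [_ ->]; auto.
  - intros x x' y H H'. apply related_graph in H as [H ->]; [|exact Hh].
    apply related_graph in H' as [H' E]; [|exact Hh]. auto.
Qed.

Lemma injection_fun (f A B : M) : is_injection f A B ->
  exists h, definable_fun h /\ (forall x, x ∈ A -> h x ∈ B) /\
    (forall x x', x ∈ A -> x' ∈ A -> h x = h x' -> x = x') /\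
    forall x y, related f x y <-> x ∈ A /\ y = h x.
Proof.
  intros [(Sf & Hf & Hu) Hi].
  pose (h := fun x => the (fun y => related f x y)).
  assert (Hr : forall x y, related f x y <-> x ∈ A /\ y = h x).
  { assert (K : forall x, x ∈ A -> related f x (h x)).
    { intros x Hx. destruct (Hu x Hx) as (y & Hy & Hy').
      unfold h. rewrite (the_eq _ y); auto. intros y' H. symmetry; auto. }
    intros x y. split.
    - intros H. assert (Hx : x ∈ A).
      { destruct H as (p & Hp & E). destruct (Hf p Hp) as (x' & y' & Hx & _ & E').
        apply is_opair_iff in E, E'. subst p. now apply opair_inj in E' as [-> _]. }
      split; [exact Hx|]. destruct (Hu x Hx) as (y0 & _ & Hy0).
      rewrite <- (Hy0 y H). now apply Hy0, K.
    - intros [Hx ->]; auto. }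
  exists h. split; [intros g Hg; unfold h; dfn|split; [|split; [|exact Hr]]].
  - intros x Hx. assert (H : related f x (h x)) by now apply Hr.
    destruct H as (p & Hp & E). destruct (Hf p Hp) as (x' & y' & _ & Hy & E').
    apply is_opair_iff in E, E'. subst p. now apply opair_inj in E' as [_ ->].
  - intros x x' Hx Hx' E. apply (Hi x x' (h x)); apply Hr; auto.
Qed.

Lemma injects_iff (A B : M) : injects A B <-> inj A B.
Proof.
  split.
  - intros (f & Hf). destruct (injection_fun f A B Hf) as (h & H1 & H2 & H3 & _).
    now exists h.
  - intros (h & H1 & H2 & H3). exists (graph h A). now apply graph_injection.
Qed.

Lemma inj_trans (A B C : M) : inj A B -> inj B C -> inj A C.
Proof.
  intros (h & H1 & H2 & H3) (k & K1 & K2 & K3). exists (fun x => k (h x)).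
  split; [intros f Hf; dfn|split; auto].
Qed.

Lemma inj_subset (A B : M) : subset A B -> inj A B.
Proof. intros H. exists (fun x => x). split; [intros f Hf; exact Hf|split; auto]. Qed.

Section Automorphism.

Context (j : M -> M) (Hj : definable_fun j).
Context (j_ur : forall u, ur u -> ur (j u)) (j_inv : forall u, ur u -> j (j u) = u).

Definition act_step (c x s : M) : M :=
  the (fun v => (ur x /\ v = j x) \/ (is_set x /\ v = s)).

Definition act (x : M) : M := rec mem act_step empty x.

Lemma term_act_step f g h : definable_term f -> definable_term g -> definable_term h ->
  definable_term (fun e => act_step (f e) (g e) (h e)).
Proof. unfold act_step. intros; dfn. Qed.

Lemma definable_act : definable_fun act.
Proof. intros f Hf. apply (term_rec _ _ def_mem_rel term_act_step); dfn. Qed.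

Lemma act_urelement (x : M) : ur x -> act x = j x.
Proof.
  intros U. unfold act. rewrite (rec_eq _ _ def_mem_rel term_act_step mem_min mem_hull).
  apply the_eq; [auto|]. intros y [[_ H]|[S _]]; [exact H|destruct (S U)].
Qed.

Lemma act_set (x : M) : is_set x ->
  is_set (act x) /\ forall z, z ∈ act x <-> exists y, y ∈ x /\ z = act y.
Proof.
  intros S. unfold act at 1 2. rewrite (rec_eq _ _ def_mem_rel term_act_step mem_min mem_hull).
  unfold act_step. rewrite (the_eq _ (rec_values mem act_step empty x)).
  - split; [apply comp_set|]. intros z.
    apply (in_rec_values _ _ def_mem_rel term_act_step mem_hull).
  - auto.
  - intros y [[U _]|[_ H]]; [destruct (S U)|exact H].
Qed.

Lemma act_is_ur (x : M) : ur (act x) <-> ur x.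
Proof.
  split.
  - intros U. apply NNPP. intros S. now apply act_set in S as [S _].
  - intros U. rewrite act_urelement by exact U. auto.
Qed.

Lemma act_involutive : forall x, act (act x) = x.
Proof.
  pose proof definable_act as Ha.
  mem_induction. intros x IH. destruct (classic (ur x)) as [U|S].
  - rewrite (act_urelement x U), act_urelement by auto. auto.
  - destruct (act_set x S) as [S1 H1]. destruct (act_set _ S1) as [S2 H2].
    apply set_ext; auto. intros z. rewrite H2. split.
    + intros (y & Hy & ->). apply H1 in Hy as (w & Hw & ->). now rewrite IH.
    + intros Hz. exists (act z). split; [apply H1; eauto|]. symmetry; auto.
Qed.

Lemma act_mem (x y : M) : act x ∈ act y <-> x ∈ y.
Proof.
  assert (K : forall x y, x ∈ y -> act x ∈ act y).
  { intros x' y' H. apply (act_set y' (mem_is_set _ _ H)). eauto. }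
  split; [|apply K]. intros H. apply K in H. now rewrite !act_involutive in H.
Qed.

Lemma sat_act (p : form) : forall e : env, sat M e p <-> sat M (fun k => act (e k)) p.
Proof.
  assert (E : forall a e, (fun k => act (scons a e k)) = scons (act a) (fun k => act (e k))).
  { intros a e. apply functional_extensionality; now intros [|k]. }
  induction p; intros e; simpl; try tauto.
  - split; [congruence|]. intros H. apply (f_equal act) in H. now rewrite !act_involutive in H.
  - now rewrite act_mem.
  - now rewrite act_is_ur.
  - rewrite IHp1, IHp2; tauto.
  - rewrite IHp1, IHp2; tauto.
  - rewrite IHp1, IHp2; tauto.
  - split; intros H a.
    + specialize (H (act a)). now rewrite IHp, E, act_involutive in H.
    + now rewrite IHp, E.
  - split; intros [a H]; exists (act a).
    + now rewrite IHp, E in H.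
    + now rewrite IHp, E, act_involutive.
Qed.

Lemma over_act (X Y : M) : ur_set X -> (forall u, u ∈ X -> j u ∈ Y) ->
  forall y, over X y -> over Y (act y).
Proof.
  pose proof definable_act as Ha.
  intros HX HXY. mem_induction. intros y IH H. apply over_iff in H as [H|[S H]].
  - left. rewrite act_urelement; [auto|now apply HX].
  - apply over_iff. right. destruct (act_set y S) as [S' H']. split; [exact S'|].
    intros z Hz. apply H' in Hz as (w & Hw & ->). auto.
Qed.

Lemma act_fixes (X : M) : ur_set X -> (forall u, u ∈ X -> j u = u) ->
  forall y, over X y -> act y = y.
Proof.
  pose proof definable_act as Ha.
  intros HX HXY. mem_induction. intros y IH H. apply over_iff in H as [H|[S H]].
  - rewrite act_urelement; [auto|now apply HX].
  - destruct (act_set y S) as [S' H']. apply set_ext; auto.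
    intros z. rewrite H'. split.
    + intros (w & Hw & ->). rewrite IH; auto.
    + intros Hz. exists z. split; [exact Hz|]. symmetry; auto.
Qed.

End Automorphism.

Lemma swap_automorphism (E E' : M) : ur_set E -> ur_set E' -> disjoint E E' -> inj E E' ->
  exists f : M -> M,
    (forall (p : form) (e : env), sat M e p <-> sat M (fun k => f (e k)) p) /\
    forall X, ur_set X -> disjoint X E -> disjoint X E' ->
      (forall y, over X y -> f y = y) /\
      (forall y, over (cup X E) y -> over (cup X E') (f y)).
Proof.
  intros [_ HE] [_ HE'] HD (h & Hh & HhE & Hi).
  pose (j := fun u => the (fun v => (u ∈ E /\ v = h u)
    \/ (~ u ∈ E /\ (exists w, w ∈ E /\ u = h w /\ v = w))
    \/ (~ u ∈ E /\ ~ (exists w, w ∈ E /\ u = h w) /\ v = u))).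
  assert (Hj : definable_fun j) by (intros f Hf; unfold j; dfn).
  assert (j1 : forall u, u ∈ E -> j u = h u).
  { intros u Hu. apply the_eq; [auto|]. intros y. tauto. }
  assert (j2 : forall w, w ∈ E -> j (h w) = w).
  { intros w Hw. assert (N : ~ h w ∈ E) by (intros N; apply (HD (h w)); auto).
    apply the_eq.
    - right; left. split; [exact N|]. eauto.
    - intros y [[H _]|[(_ & w' & Hw' & H & ->)|(_ & H & _)]]; [tauto| |destruct H; eauto].
      symmetry; auto. }
  assert (j3 : forall u, ~ u ∈ E -> ~ (exists w, w ∈ E /\ u = h w) -> j u = u).
  { intros u H1 H2. apply the_eq; [auto|]. intros y [[H _]|[(_ & w & H & H' & _)|H]]; try tauto.
    destruct H2; eauto. }
  assert (jur : forall u, ur u -> ur (j u)).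
  { intros u Hu. destruct (classic (u ∈ E)) as [H|H]; [rewrite j1; auto|].
    destruct (classic (exists w, w ∈ E /\ u = h w)) as [(w & Hw & ->)|H']; [rewrite j2; auto|].
    now rewrite j3. }
  assert (jinv : forall u, ur u -> j (j u) = u).
  { intros u Hu. destruct (classic (u ∈ E)) as [H|H].
    - rewrite (j1 u H). auto.
    - destruct (classic (exists w, w ∈ E /\ u = h w)) as [(w & Hw & ->)|H'].
      + now rewrite (j2 w Hw), j1.
      + now rewrite !j3 by (rewrite ?j3; assumption). }
  exists (act j). split; [exact (sat_act j Hj jur jinv)|].
  intros X [SX HX] XE XE'.
  assert (jX : forall u, u ∈ X -> j u = u).
  { intros u Hu. apply j3.
    - intros H. apply (XE u); auto.
    - intros (w & Hw & ->). apply (XE' (h w)); auto. }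
  split.
  - apply act_fixes; auto. split; auto.
  - apply over_act; auto.
    + split; [apply comp_set|]. intros u Hu. apply in_cup in Hu as [Hu|Hu]; auto.
    + intros u Hu. apply in_cup in Hu as [Hu|Hu]; apply in_cup.
      * left. now rewrite jX.
      * right. rewrite j1; auto.
Qed.

Lemma def_injects f g :
  definable_term f -> definable_term g -> definable (fun e => injects (f e) (g e)).
Proof.
  intros. unfold injects, is_injection, is_function.
  apply (def_ext (fun e => exists h, (is_set h /\
    (forall p, p ∈ h -> exists x y, x ∈ f e /\ y ∈ g e /\ p = opair x y) /\
    (forall x, x ∈ f e -> exists y, related h x y /\ forall y', related h x y' -> y = y')) /\
    forall x x' y, related h x y -> related h x' y -> x = x')); [|dfn].
  intros e. unfold unique. setoid_rewrite is_opair_iff. reflexivity.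
Qed.
Hint Resolve def_injects : dfn.

Lemma def_ur_set f : definable_term f -> definable (fun e => ur_set (f e)).
Proof. unfold ur_set. intros; dfn. Qed.
Hint Resolve def_ur_set : dfn.

Lemma def_disjoint f g :
  definable_term f -> definable_term g -> definable (fun e => disjoint (f e) (g e)).
Proof. unfold disjoint. intros; dfn. Qed.
Hint Resolve def_disjoint : dfn.

Lemma def_is_tail f g :
  definable_term f -> definable_term g -> definable (fun e => is_tail (f e) (g e)).
Proof. unfold is_tail. intros; dfn. Qed.
Hint Resolve def_is_tail : dfn.

(** * Minimal tails *)

Section WellOrder.

Context (r B : M) (Hr : well_orders r B).

Definition segment (c : M) : M := sep B (fun y => related r y c).

Lemma term_segment f : definable_term f -> definable_term (fun e => segment (f e)).
Proof. unfold segment. intros; dfn. Qed.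
Hint Resolve term_segment : dfn.

Lemma in_segment (c y : M) : y ∈ segment c <-> y ∈ B /\ related r y c.
Proof. apply (in_sep B (fun y => related r y c)). dfn. Qed.

Lemma wo_irrefl (x : M) : x ∈ B -> ~ related r x x.
Proof. exact (proj1 (proj2 Hr) x). Qed.

Lemma wo_asym (x y : M) : x ∈ B -> y ∈ B -> related r x y -> related r y x -> False.
Proof.
  intros Hx Hy H H'. apply (wo_irrefl x Hx).
  exact (proj1 (proj2 (proj2 Hr)) x y x Hx Hy Hx H H').
Qed.

Lemma wo_least (P : M -> Prop) : definable (fun e => P (e 0)) ->
  (exists x, x ∈ B /\ P x) ->
  exists m, m ∈ B /\ P m /\ forall x, x ∈ B -> P x -> x = m \/ related r m x.
Proof.
  intros HP (x & Hx & Px).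
  assert (Hs : forall z, z ∈ sep B P <-> z ∈ B /\ P z) by (intros; apply in_sep; dfn).
  destruct (proj2 (proj2 (proj2 (proj2 Hr))) (sep B P)) as (m & Hm & Hl).
  - apply comp_set.
  - intros z Hz. now apply Hs in Hz.
  - exists x. now apply Hs.
  - apply Hs in Hm as [Hm Pm]. exists m. split; [exact Hm|split; [exact Pm|]].
    intros y Hy Py. apply Hl, Hs. auto.
Qed.

Definition below (y x : M) : Prop := y ∈ B /\ x ∈ B /\ related r y x.

Lemma def_below f g :
  definable_term f -> definable_term g -> definable (fun e => below (f e) (g e)).
Proof. unfold below. intros; dfn. Qed.
Hint Resolve def_below : dfn.

Lemma below_min s : (exists y, y ∈ s) -> exists y, y ∈ s /\ forall z, z ∈ s -> ~ below z y.
Proof.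
  intros (y & Hy). destruct (classic (exists x, x ∈ B /\ x ∈ s)) as [H|H].
  - destruct (wo_least (fun x => x ∈ s)) as (m & Bm & Hm & Hl); [dfn|exact H|].
    exists m. split; [exact Hm|]. intros z Hz (Bz & _ & Hzm).
    destruct (Hl z Bz Hz) as [->|K].
    + exact (wo_irrefl _ Bm Hzm).
    + exact (wo_asym _ _ Bm Bz K Hzm).
  - exists y. split; [exact Hy|]. intros z Hz (Bz & _). apply H. eauto.
Qed.

Lemma below_hull x : exists d, x ∈ d /\ R_closed below d.
Proof.
  exists (cup B (upair x x)). split; [apply in_cup; right; apply in_upair; auto|].
  intros y z _ (Hy & _). apply in_cup; auto.
Qed.

(** Enumerate [S] along [B], each [x ∈ B] going to the least element of [S] not
    yet hit: either the enumeration never stops, or it exhausts [S] at some [c]. *)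
Lemma wo_subset_compare (S : M) : subset S B ->
  inj B S \/ exists c, c ∈ B /\ inj S (segment c) /\ inj (segment c) S.
Proof.
  intros SB.
  pose (F := fun c x s : M => the (fun m => (m ∈ S /\ ~ m ∈ s) /\
     forall y, y ∈ S -> ~ y ∈ s -> y = m \/ related r m y)).
  assert (HF : forall f g h, definable_term f -> definable_term g -> definable_term h ->
     definable_term (fun e => F (f e) (g e) (h e))) by (intros; unfold F; dfn).
  pose (g := rec below F empty).
  pose (pre := rec_values below F empty).
  assert (Hg : definable_fun g).
  { intros f Hf. apply (term_rec _ _ def_below HF); dfn. }
  assert (Hpre : definable_fun pre).
  { intros f Hf. apply (term_rec_values _ _ def_below HF); dfn. }
  assert (in_pre : forall x v, v ∈ pre x <-> exists y, below y x /\ v = g y)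
    by (intros; apply (in_rec_values _ _ def_below HF below_hull)).
  assert (g_eq : forall x, g x = F empty x (pre x))
    by (intros; apply (rec_eq _ _ def_below HF below_min below_hull)).
  assert (g_new : forall x, (exists y, y ∈ S /\ ~ y ∈ pre x) -> g x ∈ S /\ ~ g x ∈ pre x).
  { intros x (y & Hy & Ny).
    destruct (wo_least (fun y => y ∈ S /\ ~ y ∈ pre x)) as (m & Bm & Hm & Hl); [dfn|eauto|].
    replace (g x) with m; [exact Hm|]. rewrite g_eq. symmetry. apply the_eq.
    - split; [exact Hm|]. auto.
    - intros m' ((Sm' & Nm') & Hl').
      destruct (Hl m' (SB _ Sm') (conj Sm' Nm')) as [|K]; [assumption|].
      destruct (Hl' m (proj1 Hm) (proj2 Hm)) as [|K']; [congruence|].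
      destruct (wo_asym m m'); auto. }
  assert (g_inj : forall x x', x ∈ B -> x' ∈ B -> ~ g x ∈ pre x -> ~ g x' ∈ pre x' ->
      g x = g x' -> x = x').
  { intros x x' Hx Hx' N N' E.
    destruct (proj1 (proj2 (proj2 (proj2 Hr))) x x' Hx Hx') as [H|[H|H]]; [|exact H|].
    - destruct N'. apply in_pre. exists x. split; [repeat split; auto|congruence].
    - destruct N. apply in_pre. exists x'. split; [repeat split; auto|congruence]. }
  destruct (classic (exists c, c ∈ B /\ forall y, y ∈ S -> y ∈ pre c)) as [H|H].
  - right. apply wo_least in H; [|dfn]. destruct H as (c & Bc & Hc & Hl).
    assert (N : forall x, x ∈ segment c -> g x ∈ S /\ ~ g x ∈ pre x).
    { intros x Hx. apply in_segment in Hx as [Bx Hx]. apply g_new. apply NNPP. intros N.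
      destruct (Hl x Bx) as [->|K].
      - intros y Hy. apply NNPP. eauto.
      - exact (wo_irrefl _ Bc Hx).
      - exact (wo_asym _ _ Bx Bc Hx K). }
    exists c. split; [exact Bc|split].
    + pose (k := fun s => the (fun y => y ∈ segment c /\ s = g y)).
      assert (Hk : forall s, s ∈ S -> k s ∈ segment c /\ s = g (k s)).
      { intros s Hs. apply Hc, in_pre in Hs as (y & (By & _ & Hy) & E).
        assert (Hy' : y ∈ segment c) by now apply in_segment.
        replace (k s) with y; [auto|]. symmetry. apply the_eq; [auto|].
        intros y' [H' E']. apply g_inj.
        - now apply in_segment in H'.
        - exact By.
        - now apply N.
        - now apply N.
        - congruence. }
      exists k. split; [intros f Hf; unfold k; dfn|split].
      * intros s Hs. now apply Hk.
      * intros s s' Hs Hs' E. rewrite (proj2 (Hk s Hs)), (proj2 (Hk s' Hs')). congruence.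
    + exists g. split; [exact Hg|split].
      * intros x Hx. now apply N.
      * intros x x' Hx Hx'. apply g_inj.
        -- now apply in_segment in Hx.
        -- now apply in_segment in Hx'.
        -- now apply N.
        -- now apply N.
  - left.
    assert (N : forall x, x ∈ B -> g x ∈ S /\ ~ g x ∈ pre x).
    { intros x Hx. apply g_new. apply NNPP. intros N. apply H. exists x. split; [exact Hx|].
      intros y Hy. apply NNPP. eauto. }
    exists g. split; [exact Hg|split].
    + intros x Hx. now apply N.
    + intros x x' Hx Hx'. apply g_inj; auto; now apply N.
Qed.

Lemma wo_compare (S : M) : inj S B ->
  inj B S \/ exists c, c ∈ B /\ inj S (segment c) /\ inj (segment c) S.
Proof.
  intros (h & Hh & HB & Hi).
  assert (I : inj S (image h S)).
  { exists h. split; [exact Hh|split; [|exact Hi]]. intros x Hx. apply in_image; eauto. }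
  assert (I' : inj (image h S) S).
  { pose (k := fun y => the (fun x => x ∈ S /\ y = h x)).
    assert (Hk : forall x, x ∈ S -> k (h x) = x).
    { intros x Hx. apply the_eq; [auto|]. intros x' [Hx' E]. symmetry; auto. }
    exists k. split; [intros f Hf; unfold k; dfn|split].
    - intros y Hy. apply in_image in Hy as (x & Hx & ->); [|exact Hh]. now rewrite Hk.
    - intros y y' Hy Hy' E.
      apply in_image in Hy as (x & Hx & ->); [|exact Hh].
      apply in_image in Hy' as (x' & Hx' & ->); [|exact Hh].
      rewrite !Hk in E by assumption. congruence. }
  destruct (wo_subset_compare (image h S)) as [H|(c & Bc & H & H')].
  - intros y Hy. apply in_image in Hy as (x & Hx & ->); auto.
  - left. exact (inj_trans _ _ _ H I').
  - right. exists c. split; [exact Bc|split; eapply inj_trans; eauto].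
Qed.

End WellOrder.

Lemma ur_set_cup (A B : M) : ur_set A -> ur_set B -> ur_set (cup A B).
Proof.
  intros [_ HA] [_ HB]. split; [apply comp_set|].
  intros x Hx. apply in_cup in Hx as [Hx|Hx]; auto.
Qed.

Lemma ur_set_diff (A B : M) : ur_set A -> ur_set (diff A B).
Proof.
  intros [_ HA]. split; [apply comp_set|]. intros x Hx. apply in_diff in Hx as [Hx _]; auto.
Qed.

(** [B] is a tail of [A], and the tails of all larger sets of urelements are at
    least as large as [B]. *)
Definition stable (A B : M) : Prop :=
  ur_set A /\ ur_set B /\ disjoint B A
  /\ (forall C, ur_set C -> disjoint C A -> inj C B)
  /\ (forall E, ur_set E -> disjoint E A ->
        exists E', ur_set E' /\ disjoint E' (cup A E) /\ inj E E').

Lemma stable_exists (A : M) : tail_plus M -> ur_set A ->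
  exists A' B, subset A A' /\ stable A' B.
Proof.
  intros HT HA.
  enough (K : exists A' T, subset A A' /\ ur_set A' /\ is_tail T A' /\
    forall A'' T', ur_set A'' -> subset A' A'' -> is_tail T' A'' -> inj T T').
  { destruct K as (A' & T & AA & UA & (UT & DT & HC) & Hm).
    exists A', T. split; [exact AA|]. split; [exact UA|split; [exact UT|split; [exact DT|split]]].
    - intros C UC DC. apply injects_iff. auto.
    - intros E UE DE. destruct (HT (cup A' E)) as (T' & HT' & _); [now apply ur_set_cup|].
      exists T'. split; [apply HT'|split; [apply HT'|]].
      apply (inj_trans _ T).
      + apply injects_iff. auto.
      + apply (Hm (cup A' E)); [now apply ur_set_cup| |exact HT']. intros z Hz. apply in_cup; auto. }
  destruct (HT A HA) as (B & HB & r & Hr).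
  assert (HTB : forall A'' T', subset A A'' -> is_tail T' A'' -> inj T' B).
  { intros A'' T' AA (UT & DT & _). apply injects_iff, HB; [exact UT|].
    intros x [H1 H2]. apply (DT x); auto. }
  (* the least [b] such that some tail of a larger set injects into the segment of [b] *)
  destruct (classic (exists b, b ∈ B /\ exists A' T, subset A A' /\ ur_set A' /\ is_tail T A' /\
    injects T (segment r B b))) as [H|H].
  - apply (wo_least r B Hr) in H; [|pose proof (term_segment r B); dfn].
    destruct H as (b & Bb & (A' & T & AA & UA & T1 & T2) & Hl).
    apply injects_iff in T2. exists A', T. split; [exact AA|split; [exact UA|split; [exact T1|]]].
    intros A'' T' UA' AA' HT'.
    assert (AA'' : subset A A'') by (intros z Hz; auto).
    destruct (wo_compare r B Hr T' (HTB _ _ AA'' HT')) as [K|(c & Bc & K1 & K2)].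
    + exact (inj_trans _ _ _ (HTB _ _ AA T1) K).
    + apply (inj_trans _ (segment r B b)); [exact T2|].
      apply (inj_trans _ (segment r B c)); [|exact K2].
      apply inj_subset. intros y Hy. rewrite in_segment in *. split; [apply Hy|].
      destruct (Hl c Bc) as [->|Q].
      * exists A'', T'. now rewrite injects_iff.
      * apply Hy.
      * apply (proj1 (proj2 (proj2 Hr)) y b c); tauto.
  - exists A, B. split; [intros z Hz; exact Hz|split; [exact HA|split; [exact HB|]]].
    intros A'' T' UA AA HT'.
    destruct (wo_compare r B Hr T' (HTB _ _ AA HT')) as [K|(c & Bc & K1 & K2)]; [exact K|].
    destruct H. exists c. split; [exact Bc|]. exists A'', T'. now rewrite injects_iff.
Qed.

(** Any object over [X ∪ Y] can be moved over [X ∪ N] by an automorphism fixing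
    everything over [X], when [Y] is disjoint from [X]: first swap [Y ∪ N] with a
    fresh copy, then swap the copy of [Y] back into [N]. *)
Lemma absorb (A B X N : M) (p : form) (e : env) (y : M) :
  stable A B -> ur_set X -> subset A X -> ur_set N -> disjoint N X -> inj B N ->
  (forall k, over X (e k)) -> sat M (scons y e) p ->
  exists y', over (cup X N) y' /\ sat M (scons y' e) p.
Proof.
  intros (UA & UB & DB & HB & HE) UX AX UN DN BN He Hy.
  destruct (over_exists y) as (Y & UY & OY).
  pose (E := cup (diff Y X) N).
  assert (UE : ur_set E) by (apply ur_set_cup; [now apply ur_set_diff|exact UN]).
  assert (DE : disjoint E X).
  { intros z [H1 H2]. apply in_cup in H1 as [H1|H1].
    - apply in_diff in H1. tauto.
    - apply (DN z); auto. }
  destruct (HE (cup E (diff X A))) as (E' & UE' & DE' & IE).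
  - apply ur_set_cup; [exact UE|now apply ur_set_diff].
  - intros z [H1 H2]. apply in_cup in H1 as [H1|H1].
    + apply (DE z); auto.
    + apply in_diff in H1. tauto.
  - assert (XE : disjoint X E) by (intros z [H1 H2]; apply (DE z); auto).
    assert (XN : disjoint X N) by (intros z [H1 H2]; apply (DN z); auto).
    assert (XE' : disjoint X E').
    { intros z [H1 H2]. apply (DE' z). split; [exact H2|]. rewrite !in_cup, in_diff.
      destruct (classic (z ∈ A)); tauto. }
    destruct (swap_automorphism E E') as (f1 & S1 & F1).
    + exact UE.
    + exact UE'.
    + intros z [H1 H2]. apply (DE' z). split; [exact H2|]. rewrite !in_cup. tauto.
    + apply (inj_trans _ (cup E (diff X A))); [|exact IE].
      apply inj_subset. intros z Hz. apply in_cup; auto.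
    + destruct (swap_automorphism E' N) as (f2 & S2 & F2).
      * exact UE'.
      * exact UN.
      * intros z [H1 H2]. apply (DE' z). split; [exact H1|]. unfold E. rewrite !in_cup. tauto.
      * apply (inj_trans _ B); [|exact BN]. apply HB; [exact UE'|].
        intros z [H1 H2]. apply (DE' z). split; [exact H1|]. apply in_cup; auto.
      * destruct (F1 X UX XE XE') as [F1a F1b]. destruct (F2 X UX XE' XN) as [F2a F2b].
        exists (f2 (f1 y)). split.
        -- apply F2b, F1b. revert OY. apply over_subset. intros z Hz.
           unfold E. rewrite !in_cup, in_diff. destruct (classic (z ∈ X)); tauto.
        -- apply S1, S2 in Hy.
           replace (scons (f2 (f1 y)) e) with (fun k => f2 (f1 (scons y e k))); [exact Hy|].
           apply functional_extensionality. intros [|k]; [reflexivity|]. simpl.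
           now rewrite F1a, F2a.
Qed.

Lemma stable_halves (A B : M) : stable A B ->
  exists l r, definable_fun l /\ definable_fun r
    /\ (forall x, x ∈ B -> l x ∈ B) /\ (forall x, x ∈ B -> r x ∈ B)
    /\ (forall x x', x ∈ B -> x' ∈ B -> l x = l x' -> x = x')
    /\ (forall x x', x ∈ B -> x' ∈ B -> r x = r x' -> x = x')
    /\ (forall x x', x ∈ B -> x' ∈ B -> l x <> r x').
Proof.
  intros (UA & UB & DB & HB & HE).
  destruct (HE B UB DB) as (B2 & U2 & D2 & k & Hk & kB & ki).
  destruct (HB (cup B B2)) as (h & Hh & hB & hi).
  - now apply ur_set_cup.
  - intros z [H1 H2]. apply in_cup in H1 as [H1|H1].
    + apply (DB z); auto.
    + apply (D2 z). split; [exact H1|]. apply in_cup; auto.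
  - assert (B1 : forall x, x ∈ B -> x ∈ cup B B2) by (intros; apply in_cup; auto).
    assert (B3 : forall x, x ∈ B -> k x ∈ cup B B2) by (intros; apply in_cup; auto).
    exists h, (fun x => h (k x)). split; [exact Hh|split; [intros f Hf; dfn|]].
    repeat split; auto.
    intros x x' Hx Hx' E. apply hi in E; auto. subst x.
    apply (D2 (k x')). split; [auto|]. apply in_cup; auto.
Qed.

Definition first (p : M) : M := the (fun a => exists b, p = opair a b).
Definition second (p : M) : M := the (fun b => exists a, p = opair a b).

Lemma first_eq (a b : M) : first (opair a b) = a.
Proof.
  apply the_eq; [now exists b|]. intros y (c & E). apply opair_inj in E. symmetry; tauto.
Qed.

Lemma second_eq (a b : M) : second (opair a b) = b.
Proof.
  apply the_eq; [now exists a|]. intros y (c & E). apply opair_inj in E. symmetry; tauto.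
Qed.

Lemma term_first f : definable_term f -> definable_term (fun e => first (f e)).
Proof. unfold first. intros; dfn. Qed.
Hint Resolve term_first : dfn.

Lemma term_second f : definable_term f -> definable_term (fun e => second (f e)).
Proof. unfold second. intros; dfn. Qed.
Hint Resolve term_second : dfn.

Definition prod (x y : M) : M :=
  comp (fun p => exists a b, a ∈ x /\ b ∈ y /\ p = opair a b).

Lemma in_prod (x y p : M) : p ∈ prod x y <-> exists a b, a ∈ x /\ b ∈ y /\ p = opair a b.
Proof.
  use_comp (power (power (cup x y))); [dfn|]. intros q (a & b & Ha & Hb & ->).
  apply in_power. split; [apply comp_set|]. intros z Hz.
  apply in_power. apply in_upair in Hz as [-> | ->]; (split; [apply comp_set|]);
    intros w Hw; apply in_upair in Hw as [-> | ->]; apply in_cup; auto.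
Qed.

Lemma term_prod f g :
  definable_term f -> definable_term g -> definable_term (fun e => prod (f e) (g e)).
Proof. unfold prod. intros; dfn. Qed.
Hint Resolve term_prod : dfn.

Lemma plenitude_duplication : plenitude_plus M -> duplication M.
Proof.
  intros HP A [SA UA].
  destruct (HP (prod A (power A)) (comp_set _)) as (E & [_ UE] & f & Hf & _).
  destruct (injection_fun _ _ _ Hf) as (h & Hh & hE & hi & _).
  pose (d := fun a => sep A (fun y => exists s, s ∈ power A /\ y = h (opair a s) /\ ~ y ∈ s)).
  pose (g := fun a => h (opair a (d a))).
  assert (Hd : definable_fun d) by (intros k Hk; unfold d; dfn).
  assert (Hg : definable_fun g) by (intros k Hk; unfold g; dfn).
  assert (in_d : forall a y, y ∈ d a <->
      y ∈ A /\ exists s, s ∈ power A /\ y = h (opair a s) /\ ~ y ∈ s).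
  { intros a y.
    apply (in_sep A (fun y => exists s, s ∈ power A /\ y = h (opair a s) /\ ~ y ∈ s)). dfn. }
  assert (dA : forall a, d a ∈ power A).
  { intros a. apply in_power. split; [apply comp_set|]. intros y Hy. now apply in_d in Hy. }
  assert (pA : forall a, a ∈ A -> opair a (d a) ∈ prod A (power A)).
  { intros a Ha. apply in_prod. eauto. }
  assert (gi : forall a a', a ∈ A -> a' ∈ A -> g a = g a' -> a = a').
  { intros a a' Ha Ha' K. apply hi in K; auto. now apply opair_inj in K. }
  (* Cantor's diagonal argument. *)
  assert (gA : forall a, a ∈ A -> ~ g a ∈ A).
  { intros a Ha Ga.
    assert (N : ~ g a ∈ d a).
    { intros K. pose proof K as K'. apply in_d in K' as (_ & s & Hs & Es & Ns).
      apply hi in Es; [|auto|apply in_prod; eauto].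
      apply opair_inj in Es as [_ <-]. auto. }
    apply N, in_d. split; [exact Ga|]. exists (d a). auto. }
  pose (k := fun b => the (fun a => a ∈ A /\ b = g a)).
  assert (Hk : definable_fun k) by (intros u Hu; unfold k; dfn).
  assert (kg : forall a, a ∈ A -> k (g a) = a).
  { intros a Ha. apply the_eq; [auto|]. intros a' [Ha' K]. symmetry; auto. }
  assert (in_B : forall b, b ∈ image g A <-> exists a, a ∈ A /\ b = g a)
    by (intros; now apply in_image).
  exists (image g A). split; [|split].
  - split; [apply comp_set|]. intros b Hb. apply in_B in Hb as (a & Ha & ->).
    apply UE, hE. auto.
  - intros b [Hb Hb']. apply in_B in Hb as (a & Ha & ->). exact (gA a Ha Hb').
  - exists (graph k (image g A)). split.
    + apply graph_injection; [exact Hk| |].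
      * intros b Hb. apply in_B in Hb as (a & Ha & ->). now rewrite kg.
      * intros b b' Hb Hb' K. apply in_B in Hb as (a & Ha & ->).
        apply in_B in Hb' as (a' & Ha' & ->). rewrite !kg in K by assumption. congruence.
    + intros a Ha. exists (g a). split; [apply in_B; eauto|].
      apply related_graph; [exact Hk|]. split; [apply in_B; eauto|]. symmetry; auto.
Qed.

(** * Reflection *)

Lemma sat_agree (p : form) : forall e e' : env,
  (forall k, free p k -> e k = e' k) -> (sat M e p <-> sat M e' p).
Proof.
  assert (Q : forall p (e e' : env) a, (forall k, free p (S k) -> e k = e' k) ->
    forall k, free p k -> scons a e k = scons a e' k) by (intros ? ? ? ? ? [|k] ?; simpl; auto).
  induction p; intros e e' H; simpl in *; try tauto.
  - rewrite (H i), (H j) by auto. tauto.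
  - rewrite (H i), (H j) by auto. tauto.
  - rewrite (H i) by auto. tauto.
  - rewrite (IHp1 e e'), (IHp2 e e') by auto. tauto.
  - rewrite (IHp1 e e'), (IHp2 e e') by auto. tauto.
  - rewrite (IHp1 e e'), (IHp2 e e') by auto. tauto.
  - split; intros K a; apply (IHp (scons a e) (scons a e') (Q p e e' a H)), K.
  - split; intros [a K]; exists a; apply (IHp (scons a e) (scons a e') (Q p e e' a H)), K.
Qed.

Lemma def_sat (p : form) : forall s : env -> env,
  (forall i, definable_term (fun e => s e i)) -> definable (fun e => sat M (s e) p).
Proof.
  assert (Q : forall s : env -> env, (forall i, definable_term (fun e => s e i)) ->
    forall i, definable_term (fun e => scons (e 0) (s (tl e)) i)).
  { intros s H [|i]; simpl; [dfn|]. exact (term_ren S _ (H i)). }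
  induction p; intros s H; simpl.
  - apply def_eq; auto.
  - apply def_mem; auto.
  - apply def_ur; auto.
  - apply def_const.
  - apply def_imp; auto.
  - apply def_and; auto.
  - apply def_or; auto.
  - apply (def_all (fun a e => sat M (scons a (s e)) p)). apply IHp. auto.
  - apply (def_ex (fun a e => sat M (scons a (s e)) p)). apply IHp. auto.
Qed.

Fixpoint tuples (n : nat) (v : M) : M :=
  match n with
  | O => upair empty empty
  | S n' => prod v (tuples n' v)
  end.

Fixpoint code (n : nat) (e : env) : M :=
  match n with
  | O => empty
  | S n' => opair (e 0) (code n' (tl e))
  end.

(** Inverse to [code]; on tuples of length [n], positions from [n] on decode to
    [empty]. *)
Fixpoint decode (a : M) (i : nat) : M :=
  match i with
  | O => first a
  | S i' => decode (second a) i'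
  end.

Lemma decode_code (n : nat) : forall (e : env) i, i < n -> decode (code n e) i = e i.
Proof.
  induction n as [|n IH]; intros e i Hi; [lia|]. simpl code. destruct i as [|i]; simpl.
  - apply first_eq.
  - rewrite second_eq. apply (IH (tl e)). lia.
Qed.

Lemma code_tuples (n : nat) (v : M) : forall e : env,
  (forall i, i < n -> e i ∈ v) -> code n e ∈ tuples n v.
Proof.
  induction n as [|n IH]; intros e He; simpl.
  - apply in_upair; auto.
  - apply in_prod. exists (e 0), (code n (tl e)). repeat split.
    + apply He; lia.
    + apply IH. intros i Hi. apply He. lia.
Qed.

Lemma over_empty (A : M) : over A empty.
Proof.
  apply over_iff. right. split; [apply comp_set|].
  intros z Hz. destruct (not_in_empty _ Hz).
Qed.

Lemma decode_empty (i : nat) : decode empty i = empty.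
Proof.
  assert (E : forall a b, empty <> opair a b).
  { intros a b E. apply (not_in_empty (upair a a)). rewrite E. apply in_upair; auto. }
  assert (T : forall P : M -> Prop, (forall y, ~ P y) -> the P = empty).
  { intros P HP. destruct (the_is_the P) as [[H _]|(_ & S & H)]; [destruct (HP _ H)|].
    apply set_ext; [exact S|apply comp_set|].
    intros z; split; intros Hz; exfalso; [eapply H|eapply not_in_empty]; eauto. }
  induction i as [|i IH]; simpl.
  - apply T. intros y (b & K). exact (E _ _ K).
  - unfold second. rewrite T; [exact IH|]. intros y (b & K). exact (E _ _ K).
Qed.

Lemma decode_over (A v : M) (n : nat) : (forall z, z ∈ v -> over A z) ->
  forall a, a ∈ tuples n v -> forall i, over A (decode a i).
Proof.
  intros Hv. induction n as [|n IH]; simpl; intros a Ha i.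
  - apply in_upair in Ha as [-> | ->]; rewrite decode_empty; apply over_empty.
  - apply in_prod in Ha as (x & b & Hx & Hb & ->). destruct i as [|i]; simpl.
    + rewrite first_eq. auto.
    + rewrite second_eq. auto.
Qed.

Lemma term_tuples n f : definable_term f -> definable_term (fun e => tuples n (f e)).
Proof. intros H. induction n as [|n IH]; simpl; dfn. Qed.
Hint Resolve term_tuples : dfn.

Lemma term_decode i : forall f, definable_term f -> definable_term (fun e => decode (f e) i).
Proof. induction i as [|i IH]; intros f H; simpl; [dfn|]. apply IH; dfn. Qed.

Lemma def_sat_decode q f g : definable_term f -> definable_term g ->
  definable (fun e => sat M (scons (f e) (decode (g e))) q).
Proof.
  intros Hf Hg. apply (def_sat q (fun e => scons (f e) (decode (g e)))).
  intros [|i]; simpl; [exact Hf|]. now apply term_decode.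
Qed.
Hint Resolve def_sat_decode : dfn.

Lemma def_all_in (l : list form) (P : form -> env -> Prop) :
  (forall q, definable (P q)) -> definable (fun e => forall q, In q l -> P q e).
Proof.
  intros HP. induction l as [|q l IH].
  - apply (def_ext (fun _ => True)); [|apply def_const]. simpl. firstorder.
  - apply (def_ext (fun e => P q e /\ forall q', In q' l -> P q' e)).
    + intros e. simpl. split; [intros [H1 H2] q' [<-|H]; auto|intros H; split; auto].
    + apply def_and; auto.
Qed.

Fixpoint witnessed (p : form) : list form :=
  match p with
  | FEq _ _ | FMem _ _ | FUr _ | FBot => []
  | FImp p q | FAnd p q | FOr p q => witnessed p ++ witnessed q
  | FAll p => FImp p FBot :: witnessed p
  | FEx p => p :: witnessed p
  end.

(** Tarski-Vaught test; a universal quantifier is handled through a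
    counterexample. *)
Lemma tarski_vaught (t : M) (p : form) :
  (forall q, In q (witnessed p) -> forall e : env, (forall k, free q (S k) -> e k ∈ t) ->
     (exists a, sat M (scons a e) q) -> exists a, a ∈ t /\ sat M (scons a e) q) ->
  forall e : env, (forall k, free p k -> e k ∈ t) -> (sat M e p <-> sat_rel M t e p).
Proof.
  assert (Q : forall p (e : env) a, (forall k, free p (S k) -> e k ∈ t) -> a ∈ t ->
    forall k, free p k -> scons a e k ∈ t) by (intros ? ? ? ? ? [|k] ?; simpl; auto).
  induction p; intros H e He; simpl in *; try tauto.
  - rewrite (IHp1 ltac:(intros; apply H; auto using in_or_app) e),
      (IHp2 ltac:(intros; apply H; auto using in_or_app) e) by auto. tauto.
  - rewrite (IHp1 ltac:(intros; apply H; auto using in_or_app) e),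
      (IHp2 ltac:(intros; apply H; auto using in_or_app) e) by auto. tauto.
  - rewrite (IHp1 ltac:(intros; apply H; auto using in_or_app) e),
      (IHp2 ltac:(intros; apply H; auto using in_or_app) e) by auto. tauto.
  - split.
    + intros K a Ha. apply IHp; eauto.
    + intros K a. apply NNPP. intros N.
      destruct (H (FImp p FBot) (or_introl eq_refl) e) as (b & Hb & Nb).
      * simpl. intros k [Hk|[]]; auto.
      * exists a. exact N.
      * apply Nb. apply IHp; eauto.
  - split.
    + intros K. destruct (H p (or_introl eq_refl) e He K) as (b & Hb & Sb).
      exists b. split; [exact Hb|]. apply IHp; eauto.
    + intros (a & Ha & K). exists a. apply IHp in K; eauto.
Qed.

Lemma free_bounded (p : form) : exists n, forall k, free p k -> k < n.
Proof.
  induction p; simpl; repeat match goal with H : exists _, _ |- _ => destruct H as [? H] end.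
  1, 2: exists (S (i + j)); intros; lia.
  - exists (S i); intros; lia.
  - exists 0; tauto.
  - exists (x0 + x); intros k [K|K]; [apply IHp1 in K|apply IHp2 in K]; lia.
  - exists (x0 + x); intros k [K|K]; [apply IHp1 in K|apply IHp2 in K]; lia.
  - exists (x0 + x); intros k [K|K]; [apply IHp1 in K|apply IHp2 in K]; lia.
  - exists x; intros k K; apply IHp in K; lia.
  - exists x; intros k K; apply IHp in K; lia.
Qed.

Lemma free_list_bounded (l : list form) : exists n, forall q, In q l -> forall k, free q k -> k < n.
Proof.
  induction l as [|q l [n IH]]; [exists 0; simpl; tauto|].
  destruct (free_bounded q) as [m Hm]. exists (m + n).
  intros q' [<-|Hq] k Hk; [apply Hm in Hk|apply (IH _ Hq) in Hk]; lia.
Qed.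

Section Reflection.

Context (A B : M) (HAB : stable A B).
Context (l r : M -> M) (Hl : definable_fun l) (Hr : definable_fun r).
Context (lB : forall x, x ∈ B -> l x ∈ B) (rB : forall x, x ∈ B -> r x ∈ B).
Context (l_inj : forall x x', x ∈ B -> x' ∈ B -> l x = l x' -> x = x').
Context (r_inj : forall x x', x ∈ B -> x' ∈ B -> r x = r x' -> x = x').
Context (lr : forall x x', x ∈ B -> x' ∈ B -> l x <> r x').
Context (qs : list form) (n : nat).
Context (Hn : forall q, In q qs -> forall k, free q (S k) -> k < n).

(** [used (r^k(B))] is the set [A_k]. *)
Definition used (D : M) : M := cup A (diff B D).

Lemma term_used f : definable_term f -> definable_term (fun e => used (f e)).
Proof. unfold used. intros; dfn. Qed.
Hint Resolve term_used : dfn.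

Lemma ur_set_used (D : M) : ur_set (used D).
Proof. apply ur_set_cup; [apply HAB|]. apply ur_set_diff, HAB. Qed.

(** Invariant of the sets [D = r^k(B)]. *)
Definition roomy (D : M) : Prop :=
  subset D B /\ subset (image r D) D /\ injects B (diff D (image r D)).

Lemma def_roomy f : definable_term f -> definable (fun e => roomy (f e)).
Proof. unfold roomy. intros; dfn. Qed.
Hint Resolve def_roomy : dfn.

Lemma in_image_r (D y : M) : y ∈ image r D <-> exists x, x ∈ D /\ y = r x.
Proof. now apply in_image. Qed.

Lemma roomy_start : roomy B.
Proof.
  split; [intros z Hz; exact Hz|split].
  - intros y Hy. apply in_image_r in Hy as (x & Hx & ->). auto.
  - apply injects_iff. exists l. split; [exact Hl|split; [|exact l_inj]].
    intros x Hx. apply in_diff. split; [auto|]. intros K.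
    apply in_image_r in K as (y & Hy & K). exact (lr _ _ Hx Hy K).
Qed.

Lemma roomy_next (D : M) : roomy D -> roomy (image r D).
Proof.
  intros (DB & rD & I). split; [|split].
  - intros z Hz; auto.
  - intros y Hy. apply in_image_r in Hy as (x & Hx & ->). apply in_image_r. eauto.
  - apply injects_iff in I as (m & Hm & mD & mi). apply injects_iff.
    exists (fun x => r (m x)). split; [intros f Hf; dfn|split].
    + intros x Hx. apply mD, in_diff in Hx as [H1 H2]. apply in_diff. split.
      * apply in_image_r. eauto.
      * intros K. apply in_image_r in K as (y & Hy & K). apply H2.
        apply r_inj in K; auto. now rewrite K.
    + intros x x' Hx Hx' K. apply mi; auto. apply r_inj; auto.
      * apply mD, in_diff in Hx. apply DB, Hx.
      * apply mD, in_diff in Hx'. apply DB, Hx'.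
Qed.

Definition reflects (v w : M) : Prop :=
  subset v w /\ forall q, In q qs -> forall a, a ∈ tuples n v ->
    (exists y, sat M (scons y (decode a)) q) ->
    exists y, y ∈ w /\ sat M (scons y (decode a)) q.

Lemma def_reflects f g :
  definable_term f -> definable_term g -> definable (fun e => reflects (f e) (g e)).
Proof.
  intros Hf Hg. unfold reflects. apply def_and; [dfn|].
  apply (def_all_in qs (fun q e => forall a, a ∈ tuples n (f e) ->
    (exists y, sat M (scons y (decode a)) q) ->
    exists y, y ∈ g e /\ sat M (scons y (decode a)) q)).
  intros q. dfn.
Qed.
Hint Resolve def_reflects : dfn.

Lemma witnesses_moved (D v : M) (q : form) (a : M) : roomy D ->
  (forall z, z ∈ v -> over (used D) z) -> a ∈ tuples n v ->
  (exists y, sat M (scons y (decode a)) q) ->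
  exists y, over (used (image r D)) y /\ sat M (scons y (decode a)) q.
Proof.
  intros (DB & rD & I) Hv Ha (y & Hy).
  destruct HAB as (UA & UB & DBA & _).
  destruct (absorb A B (used D) (diff D (image r D)) q (decode a) y) as (y' & O & S).
  - exact HAB.
  - apply ur_set_used.
  - intros z Hz. apply in_cup; auto.
  - split; [apply comp_set|]. intros z Hz. apply in_diff in Hz as [Hz _]. apply UB; auto.
  - intros z [H1 H2]. apply in_diff in H1 as [H1 _]. apply in_cup in H2 as [H2|H2].
    + apply (DBA z); auto.
    + apply in_diff in H2. tauto.
  - now apply injects_iff.
  - intros k. exact (decode_over _ _ _ Hv a Ha k).
  - exact Hy.
  - exists y'. split; [|exact S]. revert O. apply over_subset. intros z Hz.
    unfold used in *. rewrite !in_cup, !in_diff in *.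
    destruct Hz as [[Hz|[Hz Nz]]|[Hz Nz]]; [now left| |]; right; split; auto.
Qed.

Lemma reflects_exists (D v : M) : roomy D -> (forall z, z ∈ v -> over (used D) z) ->
  exists z, reflects v (V (used (image r D)) z).
Proof.
  intros HD Hv.
  assert (C : forall qs', incl qs' qs -> exists W, (forall y, y ∈ W -> over (used (image r D)) y) /\
    forall q, In q qs' -> forall a, a ∈ tuples n v ->
      (exists y, sat M (scons y (decode a)) q) ->
      exists y, y ∈ W /\ sat M (scons y (decode a)) q).
  { induction qs' as [|q qs' IH]; intros Hi.
    - exists empty. split; [|simpl; tauto]. intros y Hy. destruct (not_in_empty _ Hy).
    - destruct IH as (W & OW & HW); [intros q' Hq'; apply Hi; now right|].
      destruct (collection (used (image r D)) (tuples n v)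
        (fun a y => sat M (scons y (decode a)) q)) as (W' & _ & OW' & HW').
      + apply ur_set_used.
      + intros f g Hf Hg. dfn.
      + exists (cup W W'). split.
        * intros y Hy. apply in_cup in Hy as [Hy|Hy]; auto.
        * intros q' [<-|Hq'] a Ha Hy.
          -- destruct (witnesses_moved D v q a HD Hv Ha Hy) as (y & Oy & Sy).
             destruct (HW' a y Ha Oy Sy) as (y' & Hy' & Sy').
             exists y'. rewrite in_cup. auto.
          -- destruct (HW q' Hq' a Ha Hy) as (y' & Hy' & Sy').
             exists y'. rewrite in_cup. auto. }
  destruct (C qs (incl_refl _)) as (W & OW & HW).
  assert (Hs : subset (cup v W) (V (used (image r D)) (cup v W))).
  { apply over_subset_V. intros z Hz. apply in_cup in Hz as [Hz|Hz]; [|auto].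
    apply Hv in Hz. revert Hz. apply over_subset. intros u Hu.
    unfold used in *. rewrite in_cup, in_diff in *. destruct Hu as [Hu|[Hu Nu]]; [auto|].
    right. split; [exact Hu|]. intros K. apply Nu. now apply HD. }
  exists (cup v W). split.
  - intros z Hz. apply Hs, in_cup; auto.
  - intros q Hq a Ha Hy. destruct (HW q Hq a Ha Hy) as (y & Hy' & Sy).
    exists y. split; [|exact Sy]. apply Hs, in_cup; auto.
Qed.

(** The least level over [X] reflecting [v]: leastness makes the choice definable. *)
Definition next (X v : M) : M :=
  the (fun w => (exists z, w = V X z) /\ reflects v w /\
    forall z, reflects v (V X z) -> subset w (V X z)).

Lemma next_spec (D v : M) : roomy D -> (forall z, z ∈ v -> over (used D) z) ->
  (exists z, next (used (image r D)) v = V (used (image r D)) z)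
  /\ reflects v (next (used (image r D)) v).
Proof.
  intros HD Hv.
  destruct (V_least (used (image r D)) (reflects v)) as (z & Hz & Hm).
  - apply ur_set_used.
  - dfn.
  - now apply reflects_exists.
  - assert (E : next (used (image r D)) v = V (used (image r D)) z).
    { apply the_eq; [split; [now exists z|auto]|].
      intros w ((z' & ->) & H1 & H2). apply subset_antisym; auto using V_set. }
    rewrite E. split; [now exists z|exact Hz].
Qed.

Definition step (s : M) : M :=
  opair (image r (first s)) (next (used (image r (first s))) (second s)).

Lemma definable_step : definable_fun step.
Proof. intros f Hf. unfold step, next. dfn. Qed.

Context (x : M) (Hx : over A x).

Definition stage (k : M) : M := iter (opair B (V (used B) (upair x x))) step k.

Lemma definable_stage : definable_fun stage.
Proof. apply definable_iter, definable_step. Qed.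

Lemma stage_spec (k : M) : k ∈ omega ->
  roomy (first (stage k)) /\ exists z, second (stage k) = V (used (first (stage k))) z.
Proof.
  pose proof definable_stage as Hs. revert k. omega_induction.
  - unfold stage. rewrite iter_empty by exact definable_step. rewrite first_eq, second_eq.
    split; [exact roomy_start|]. now exists (upair x x).
  - intros k Hk [HD [z Hz]]. unfold stage in *.
    rewrite iter_succ by (exact definable_step || exact Hk).
    unfold step at 1 3 5. rewrite first_eq, second_eq. split; [now apply roomy_next|].
    apply next_spec; [exact HD|]. rewrite Hz. intros u. apply V_over.
Qed.

Lemma stage_reflects (k : M) : k ∈ omega ->
  reflects (second (stage k)) (second (stage (succ k))).
Proof.
  intros Hk. destruct (stage_spec k Hk) as (HD & z & Hz).
  unfold stage at 2. rewrite iter_succ by (exact definable_step || exact Hk). fold (stage k).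
  unfold step. rewrite second_eq. apply next_spec; [exact HD|].
  rewrite Hz. intros u. apply V_over.
Qed.

Lemma stage_mono (k : M) : k ∈ omega -> forall m, m ∈ k ->
  subset (second (stage m)) (second (stage k)).
Proof.
  pose proof definable_stage as Hs. revert k. omega_induction.
  - intros m Hm. destruct (not_in_empty _ Hm).
  - intros k Hk IH m Hm z Hz. apply (stage_reflects k Hk).
    apply in_succ in Hm as [Hm| ->]; [|exact Hz].
    now apply (IH m Hm).
Qed.

Definition limit : M := sUnion (image (fun k => second (stage k)) omega).

Lemma in_limit (z : M) : z ∈ limit <-> exists k, k ∈ omega /\ z ∈ second (stage k).
Proof.
  assert (Hs : definable_fun (fun k => second (stage k))).
  { pose proof definable_stage. intros f Hf. dfn. }
  unfold limit. rewrite in_sUnion. split.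
  - intros (v & Hv & Hz). apply in_image in Hv as (k & Hk & ->); eauto.
  - intros (k & Hk & Hz). exists (second (stage k)). split; [|exact Hz].
    apply in_image; eauto.
Qed.

Lemma limit_directed (e : env) (m : nat) : (forall i, e i ∈ limit) ->
  exists k, k ∈ omega /\ forall i, i < m -> e i ∈ second (stage k).
Proof.
  intros He. induction m as [|m (k & Hk & IH)].
  - exists empty. split; [apply omega_inductive|]. intros; lia.
  - destruct (proj1 (in_limit _) (He m)) as (k' & Hk' & Hm).
    destruct (omega_trichotomy k Hk k' Hk') as [H|[->|H]].
    + exists k. split; [exact Hk|]. intros i Hi. destruct (PeanoNat.Nat.eq_dec i m) as [->|N].
      * now apply (stage_mono k Hk k' H).
      * apply IH. lia.
    + exists k. split; [exact Hk|]. intros i Hi. destruct (PeanoNat.Nat.eq_dec i m) as [->|N].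
      * exact Hm.
      * apply IH. lia.
    + exists k'. split; [exact Hk'|]. intros i Hi. destruct (PeanoNat.Nat.eq_dec i m) as [->|N].
      * exact Hm.
      * apply (stage_mono k' Hk' k H). apply IH. lia.
Qed.

Lemma limit_transitive : transitive_set limit.
Proof.
  split; [apply comp_set|]. intros y z Hy Hz. apply in_limit in Hy as (k & Hk & Hy).
  apply in_limit. exists k. split; [exact Hk|].
  destruct (stage_spec k Hk) as (_ & w & E). rewrite E in *.
  exact (V_transitive _ (ur_set_used _) _ _ _ Hy Hz).
Qed.

Lemma limit_contains : x ∈ limit.
Proof.
  apply in_limit. exists empty. split; [apply omega_inductive|].
  unfold stage. rewrite iter_empty by exact definable_step. rewrite second_eq.
  apply over_in_V. revert Hx. apply over_subset. intros z Hz. apply in_cup; auto.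
Qed.

Lemma limit_witnesses (q : form) : In q qs -> forall e : env,
  (forall k, free q (S k) -> e k ∈ limit) ->
  (exists a, sat M (scons a e) q) -> exists a, a ∈ limit /\ sat M (scons a e) q.
Proof.
  intros Hq e He Ha.
  pose (e' := fun k => if excluded_middle_informative (free q (S k)) then e k else x).
  destruct (limit_directed e' n) as (k & Hk & Hi).
  { intros i. unfold e'. destruct excluded_middle_informative; [auto|apply limit_contains]. }
  assert (E : forall a, sat M (scons a e) q <-> sat M (scons a (decode (code n e'))) q).
  { intros a. apply sat_agree. intros [|i] F; [reflexivity|]. simpl.
    rewrite decode_code by (eapply Hn; eauto). unfold e'.
    destruct excluded_middle_informative; tauto. }
  destruct (proj2 (stage_reflects k Hk) q Hq (code n e')) as (y & Hy & Sy).
  - now apply code_tuples.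
  - destruct Ha as (a & Ha). exists a. now apply E.
  - exists y. split; [|now apply E]. apply in_limit. exists (succ k).
    split; [|exact Hy]. now apply omega_inductive.
Qed.

End Reflection.

Lemma tail_plus_reflection (p : form) : tail_plus M -> RP M p.
Proof.
  intros HT x _.
  destruct (over_exists x) as (A0 & UA0 & Ox).
  destruct (stable_exists A0 HT UA0) as (A & B & AA & HAB).
  destruct (stable_halves A B HAB) as (l & r & Hl & Hr & lB & rB & li & ri & lr).
  destruct (free_list_bounded (witnessed p)) as (n & Hn).
  assert (Hn' : forall q, In q (witnessed p) -> forall k, free q (S k) -> k < n).
  { intros q Hq k Hk. apply (Hn q Hq) in Hk. lia. }
  assert (Ox' : over A x) by (revert Ox; now apply over_subset).
  exists (limit A B r (witnessed p) n x).
  assert (T : transitive_set (limit A B r (witnessed p) n x))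
    by exact (limit_transitive A B HAB l r Hl Hr lB rB li ri lr _ n x).
  split; [exact T|split].
  - intros z Hz. apply (proj2 T x z); [|exact Hz]. exact (limit_contains A B r Hr _ n x Ox').
  - apply tarski_vaught. 
    exact (limit_witnesses A B HAB l r Hl Hr lB rB li ri lr _ n Hn' x Ox').
Qed.

End ZFU.

Theorem theorem2p22 (M : structure) (HM : ZFU_R M) :
  (tail_plus M -> forall p : form, RP M p)
  /\ (plenitude_plus M -> duplication M).
Proof.
  split.
  - intros HT p. exact (tail_plus_reflection M HM p HT).
  - exact (plenitude_duplication M HM).
Qed.
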